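(* Let $a$ and $b$ be free random variables in a non-commutative probability space, both with free Poisson distribution of parameter $\lambda$, i.e. $\kappa_n(a)=\kappa_n(b)=\lambda$ for all $n\ge1$. Then $$\kappa_n(ab+ba)=2\cdot\sum_{\pi\in\mathcal{X}_{2n}}\lambda^{|\pi|}=2\cdot\sum_{\pi\in\mathcal{Y}_{2n}}\lambda^{2n+1-|\pi|}\qquad\text{for all } n\ge1,$$ where $|\pi|$ denotes the number of blocks of $\pi$.
   Context: A non-commutative probability space $(\mathcal{A},\varphi)$ is a unital algebra over $\mathbb{C}$ with a linear functional $\varphi$, $\varphi(1)=1$. The free cumulants are the multilinear functionals $\kappa_n:\mathcal{A}^n\to\mathbb{C}$ determined recursively by $\varphi(a_1\cdots a_n)=\sum_{\pi\in\mathcal{NC}(n)}\prod_{V\in\pi}\kappa_{|V|}(a_V)$, where for $V=\{v_1<\dots<v_k\}$, $\kappa_{|V|}(a_V)=\kappa_k(a_{v_1},\dots,a_{v_k})$; $\kappa_n(a):=\kappa_n(a,\dots,a)$. Freeness is free independence, equivalently vanishing of mixed free cumulants in $a,b$. $\mathcal{NC}(2n)$ is the set of non-crossing partitions of $[2n]=\{1,\dots,2n\}$. For $\pi\in\mathcal{NC}(2n)$, the undirected graph $\mathcal{G}_\pi$ (loops and multiple edges allowed) has as vertices the blocks of $\pi$, and for each $k=1,\dots,n$ one edge joining the block containing $2k-1$ and the block containing $2k$. $\mathcal{X}_{2n}:=\{\pi\in\mathcal{NC}(2n): \mathcal{G}_\pi\text{ is connected and bipartite}\}$. $\mathcal{Y}_{2n}$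 is the set of non-crossing partitions of $[2n]$ of the form $\sigma=\{B_1,B_3,\dots,B_{2n-1},E_1,\dots,E_r\}$ with $r\ge0$ (listed blocks pairwise distinct), where $i\in B_i$ for $i=1,3,\dots,2n-1$ and $|E_j|$ is even for $j\le r$. *)

(* Defs.v *)
From HB Require Import structures.
From mathcomp Require Import all_boot all_order all_algebra.
Set Implicit Arguments.
Unset Strict Implicit.
Unset Printing Implicit Defensive.
Import GRing.Theory.
Local Open Scope ring_scope.

(* Partitions of [N] = {1, ..., N} are partitions of 'I_N: the ordinal i stands
   for the integer i + 1.  In particular the odd elements 1, 3, ... of [2n] are
   the ordinals of even value. *)

Definition crossing (N : nat) (V W : {set 'I_N}) : bool :=
  [exists i : 'I_N, exists j : 'I_N, exists k : 'I_N, exists l : 'I_N,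
    [&& (i < j)%N, (j < k)%N, (k < l)%N, i \in V, k \in V, j \in W & l \in W]].

Definition NC (N : nat) : {set {set {set 'I_N}}} :=
  [set P | partition P [set: 'I_N] &
     [forall V in P, forall W in P, (V != W) ==> ~~ crossing V W]].

Section FreeProbability.

Variables (K : fieldType) (A : algType K) (phi : {scalar A}).

(* The tuple (s_(v_1), ..., s_(v_k)) for V = {v_1 < ... < v_k}; the enumeration
   of a set of ordinals is increasing. *)
Definition restr_seq (s : seq A) (V : {set 'I_(size s)}) : seq A :=
  [seq s`_(val i) | i <- enum V].

(* The moment-cumulant formula, solved for the term of the one-block partition;
   N bounds the depth of the recursion, and any N >= size s gives the same
   value.  See [moment_cumulant] for the formula itself. *)
Fixpoint cumulant_rec (N : nat) (s : seq A) : K :=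
  if N is M.+1 then
    phi (\prod_(x <- s) x)
    - \sum_(P in NC (size s) | P != [set setT])
        \prod_(V in P) cumulant_rec M (restr_seq V)
  else 0.

Definition cumulant (s : seq A) : K := cumulant_rec (size s) s.

Definition cumulant1 (n : nat) (a : A) : K := cumulant (nseq n a).

(* The unital subalgebra generated by x is the set of polynomials in x. *)
Definition free_family (I : eqType) (x : I -> A) : Prop :=
  forall (m : nat) (i : nat -> I) (p : nat -> {poly K}),
    (0 < m)%N ->
    (forall k, (k.+1 < m)%N -> i k != i k.+1) ->
    (forall k, (k < m)%N -> phi (horner_alg (x (i k)) (p k)) = 0) ->
    phi (\prod_(k < m) horner_alg (x (i k)) (p k)) = 0.

Definition free_pair (a b : A) : Prop :=
  free_family (fun c : bool => if c then a else b).

Definition free_poisson (lam : K) (a : A) : Prop :=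
  forall n : nat, (0 < n)%N -> cumulant1 n a = lam.

Lemma size_restr_seq (s : seq A) (V : {set 'I_(size s)}) :
  size (restr_seq V) = #|V|.
Proof. by rewrite size_map -cardE. Qed.

Lemma restr_seqT (s : seq A) : restr_seq [set: 'I_(size s)] = s.
Proof.
rewrite /restr_seq enum_setT -enumT.
have -> : [seq s`_(val i) | i <- enum 'I_(size s)]
        = [seq s`_i | i <- map val (enum 'I_(size s))] by rewrite -map_comp.
by rewrite val_enum_ord map_nth_iota0 // take_size.
Qed.

Lemma NC_block_proper (N : nat) (P : {set {set 'I_N}}) (V : {set 'I_N}) :
  P \in NC N -> P != [set setT] -> V \in P -> (#|V| < N)%N.
Proof.
rewrite inE => /andP[partP _] neqP VP.
rewrite -[X in (_ < X)%N]card_ord -cardsT; apply: proper_card.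
rewrite properT; apply: contraNneq neqP => VT; subst V.
have [/eqP covP /trivIsetP trivP P0] := and3P partP.
apply/eqP/setP => W; rewrite inE; apply/idP/eqP => [WP|-> //].
apply/eqP/negPn/negP => neqW; have := trivP _ _ WP VP neqW.
rewrite -setI_eq0 setIT => /eqP W0.
by rewrite -W0 WP in P0.
Qed.

Lemma cumulant_recE (M N : nat) (s : seq A) :
  (0 < size s)%N -> (size s <= M)%N -> (size s <= N)%N ->
  cumulant_rec M s = cumulant_rec N s.
Proof.
elim: M N s => [|M IHM] [|N] s s_gt0 sM sN //=.
- by have := leq_trans s_gt0 sM.
- by have := leq_trans s_gt0 sN.
congr (_ - _); apply: eq_bigr => P /andP[PNC neqP]; apply: eq_bigr => V VP.
have ltV := NC_block_proper PNC neqP VP.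
have V_gt0 : (0 < #|V|)%N.
  rewrite card_gt0; apply: contraTneq VP => ->.
  by move: PNC; rewrite inE => /andP[/and3P[]].
apply: IHM; rewrite size_restr_seq //.
- by rewrite -ltnS (leq_trans ltV).
- by rewrite -ltnS (leq_trans ltV).
Qed.

Lemma oneblock_NC (N : nat) : (0 < N)%N -> [set setT] \in NC N.
Proof.
move=> N_gt0; rewrite inE; apply/andP; split.
  rewrite /partition /cover big_set1 eqxx trivIset1 inE /= eq_sym.
  by rewrite -card_gt0 cardsT card_ord.
apply/forall_inP => V; rewrite inE => /eqP ->.
by apply/forall_inP => W; rewrite inE => /eqP ->; rewrite eqxx.
Qed.

Lemma moment_cumulant (s : seq A) : (0 < size s)%N ->
  phi (\prod_(x <- s) x)
  = \sum_(P in NC (size s)) \prod_(V in P) cumulant (restr_seq V).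
Proof.
move=> s_gt0; rewrite (bigD1 [set setT]) ?oneblock_NC //= big_set1 restr_seqT.
rewrite /cumulant (@cumulant_recE _ (size s).+1 s) //= -addrA.
rewrite -[LHS]addr0; congr (_ + _).
rewrite addrC; apply/esym/eqP; rewrite subr_eq0; apply/eqP.
apply: eq_bigr => P /andP[PNC neqP]; apply: eq_bigr => V VP.
have ltV := NC_block_proper PNC neqP VP.
apply: cumulant_recE; rewrite size_restr_seq // ?(ltnW ltV) // card_gt0.
apply: contraTneq VP => ->; by move: PNC; rewrite inE => /andP[/and3P[]].
Qed.

End FreeProbability.

Section PartitionClasses.

Variable n : nat.

Lemma odd_pt_subproof (k : 'I_n) : (2 * k < 2 * n)%N.
Proof. by rewrite ltn_mul2l /=. Qed.

Lemma even_pt_subproof (k : 'I_n) : ((2 * k).+1 < 2 * n)%N.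
Proof. by rewrite !mul2n -doubleS leq_double. Qed.

(* For k : 'I_n standing for k + 1 in [n], these are the elements 2(k + 1) - 1
   and 2(k + 1) of [2n]. *)
Definition odd_pt (k : 'I_n) : 'I_(2 * n) := Ordinal (odd_pt_subproof k).
Definition even_pt (k : 'I_n) : 'I_(2 * n) := Ordinal (even_pt_subproof k).

(* The graph G_P: its vertices are the blocks of P and its edges are indexed by
   'I_n, so that loops and multiple edges are allowed. *)
Definition edge_ends (P : {set {set 'I_(2 * n)}}) (k : 'I_n) :
    {set 'I_(2 * n)} * {set 'I_(2 * n)} :=
  (pblock P (odd_pt k), pblock P (even_pt k)).

Definition graph_adj (P : {set {set 'I_(2 * n)}}) : rel {set 'I_(2 * n)} :=
  fun V W => [exists k : 'I_n,
    (edge_ends P k == (V, W)) || (edge_ends P k == (W, V))].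

Definition graph_connected (P : {set {set 'I_(2 * n)}}) : bool :=
  [forall V in P, forall W in P, connect (graph_adj P) V W].

(* S is one of the two colour classes; a loop excludes bipartiteness. *)
Definition graph_bipartite (P : {set {set 'I_(2 * n)}}) : bool :=
  [exists S : {set {set 'I_(2 * n)}}, forall k : 'I_n,
    ((edge_ends P k).1 \in S) != ((edge_ends P k).2 \in S)].

Definition NCX : {set {set {set 'I_(2 * n)}}} :=
  [set P in NC (2 * n) | graph_connected P & graph_bipartite P].

(* B k is the block B_(2k+1) and E is the set {E_1, ..., E_r}. *)
Definition NCY : {set {set {set 'I_(2 * n)}}} :=
  [set P in NC (2 * n) |
    [exists B : {ffun 'I_n -> {set 'I_(2 * n)}},
     exists E : {set {set 'I_(2 * n)}},
      [&& P == [set B k | k : 'I_n] :|: E,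
          injectiveb B,
          [disjoint [set B k | k : 'I_n] & E],
          [forall k, odd_pt k \in B k]
        & [forall V in E, ~~ odd #|V|]]]].

End PartitionClasses.

(* Main.v *)
Require Import Defs.
From mathcomp Require Import all_boot all_order all_algebra.
From mathcomp Require Import zify.
From mathcomp Require Import reals complex.
Set Implicit Arguments.
Unset Strict Implicit.
Unset Printing Implicit Defensive.
Import GRing.Theory.
Local Open Scope ring_scope.


(** Why the theorem holds. A word in [a] and [b] has as its moment the sum of
    [lam ^+ #|P|] over the noncrossing partitions [P] of its positions whose
    blocks contain a single letter ([free_moment]): freeness, applied to the
    centred powers of letters that make up a word, expresses the moment of the
    word through those of shorter ones, and the sums over partitions obey the
    same relation, because such a partition always isolates some maximal run
    of equal letters ([isolated_run]).

    The [n]-th power of [a * b + b * a] is the sum of the words of length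
    [2 * n] in which the positions [2k] and [2k+1] carry different letters.
    Exchanging the sums, each noncrossing partition [P] is counted with the
    number of colourings of its blocks that are proper for its graph: none if
    the graph is not bipartite, and two per connected component otherwise. The
    components of the graph form a noncrossing partition of the [n] edges, and
    above each of its blocks sits an arbitrary connected bipartite partition;
    so the moment is the sum over the noncrossing partitions [Q] of the products
    over the blocks [V] of [Q] of twice the sum over [NCX #|V|]
    ([sum_colorings], [anticommutator_moment]). This is a moment-cumulant
    formula, and it determines the cumulants ([cumulant1_unique]).

    The second equality is Kreweras duality ([krew_NCX]). The complement of [P]
    relates two points when the interval between them is a union of blocks of
    [P]; it permutes the noncrossing partitions, and the numbers of blocks of
    [P] and of its complement add up to [2 * n + 1] ([card_krew]). The graph is
    connected exactly when the points of even value are in distinct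
    complementary blocks ([conn_krew]); the remaining complementary blocks are
    the inner faces of the graph, which is planar, and it is bipartite exactly
    when all of them have even size ([bip_face], [face_bip]). *)

(** * Noncrossing partitions of a subset *)

Section Noncrossing.
Variable N : nat.
Implicit Types (D B C : {set 'I_N}) (P Q : {set {set 'I_N}}) (i j k l x y : 'I_N).

Definition ncpart D : {set {set {set 'I_N}}} :=
  [set P | partition P D &
     [forall V in P, forall W in P, (V != W) ==> ~~ crossing V W]].

Lemma ncpartP D P : reflect
  [/\ forall B, B \in P -> exists i, i \in B,
      forall i, i \in D <-> (exists2 B, B \in P & i \in B),
      forall B C i, B \in P -> C \in P -> i \in B -> i \in C -> B = C
    & forall B C i j k l, B \in P -> C \in P -> (i < j < k)%N -> (k < l)%N ->
        i \in B -> k \in B -> j \in C -> l \in C -> B = C]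
  (P \in ncpart D).
Proof.
apply: (iffP idP); rewrite inE.
  case/andP=> /and3P[/eqP covP /trivIsetP trivP P0] /forall_inP ncP; split.
  - by move=> B BP; apply/set0Pn; apply: contraNneq P0 => <-.
  - move=> i; rewrite -covP; split=> [/bigcupP//|[B BP iB]].
    by apply/bigcupP; exists B.
  - move=> B C i BP CP iB iC; apply: contraTeq iC => /(trivP _ _ BP CP).
    by move/disjointFr->.
  move=> B C i j k l BP CP /andP[ij jk] kl iB kB jC lC.
  have /forall_inP/(_ C CP)/implyP := ncP _ BP.
  case: eqVneq => // _ /(_ isT) /negP[].
  apply/existsP; exists i; apply/existsP; exists j; apply/existsP; exists k.
  by apply/existsP; exists l; apply/and5P; split=> //; rewrite kB jC.
case=> neP covP trivP ncP; apply/andP; split; last first.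
  apply/forall_inP => B BP; apply/forall_inP => C CP; apply/implyP => /eqP neq.
  apply/negP => /existsP[i /existsP[j /existsP[k /existsP[l]]]].
  case/and5P=> ij jk kl iB /and3P[kB jC lC]; apply: neq.
  by apply: (@ncP _ _ i j k l) => //; rewrite ij.
apply/and3P; split.
- apply/eqP/setP => i; apply/bigcupP/idP => [[B BP iB]|/covP[B BP iB]].
    by apply/covP; exists B.
  by exists B.
- apply/trivIsetP => B C BP CP; apply: contra_neqT => /pred0Pn[i /andP[iB iC]].
  exact: (@trivP _ _ i).
- by apply/negP => P0; have [x] := neP _ P0; rewrite inE.
Qed.

Lemma ncpart_partition D P : P \in ncpart D -> partition P D.
Proof. by rewrite inE => /andP[]. Qed.

Lemma ncpart0 : ncpart set0 = [set set0].
Proof.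
apply/setP => P; rewrite in_set1; apply/ncpartP/eqP => [[neP covP _ _]|->].
  apply/eqP; rewrite -subset0; apply/subsetP => B BP; have [i iB] := neP B BP.
  by have: i \in set0 by [apply/covP; exists B]; rewrite inE.
by split=> [B|i|B C i|B C i j k l]; rewrite ?inE //; split=> // -[B]; rewrite inE.
Qed.

(** With [c] the indicator function of a set, this says that the set is a
    union of blocks of [P] (a saturated set); with [c] a colour of the letters
    of a word, that every block of [P] has a single colour. *)
Definition monochromatic (I : eqType) (c : 'I_N -> I) P : bool :=
  [forall B in P, forall i in B, forall j in B, c i == c j].

Lemma monoP (I : eqType) (c : 'I_N -> I) P : reflect
  (forall B i j, B \in P -> i \in B -> j \in B -> c i = c j) (monochromatic c P).
Proof.
apply: (iffP forall_inP) => mP B.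
  by move=> i j /mP/forall_inP cB /cB/forall_inP cj /cj/eqP.
move=> BP; apply/forall_inP => i iB; apply/forall_inP => j jB.
by apply/eqP; apply: mP iB jB.
Qed.

Lemma eq_mono (I : eqType) (c d : 'I_N -> I) P :
  c =1 d -> monochromatic c P = monochromatic d P.
Proof.
move=> cd; apply/monoP/monoP => mP B i j BP iB jB.
  by rewrite -!cd; apply: mP BP iB jB.
by rewrite !cd; apply: mP BP iB jB.
Qed.

Lemma monoTP (I : eqType) (c : 'I_N -> I) P : partition P setT -> reflect
  (forall i j, j \in pblock P i -> c i = c j) (monochromatic c P).
Proof.
case/and3P=> /eqP covP tP _.
have iP i : i \in cover P by rewrite covP inE.
apply: (iffP (monoP c P)) => mP => [i j ij|B i j BP iB jB].
  by apply: (mP (pblock P i)); rewrite ?pblock_mem ?mem_pblock.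
by apply: mP; rewrite (def_pblock _ BP).
Qed.

(** The open gap between two consecutive elements of a block is saturated: a
    block with a point inside the gap and a point outside would cross that
    block. *)
Lemma mono_gap P D B i j : P \in ncpart D -> B \in P -> i \in B -> j \in B ->
  (forall x, x \in B -> ~~ (i < x < j)%N) -> monochromatic (fun x => (i < x < j)%N) P.
Proof.
case/ncpartP=> _ _ tP nP BP iB jB gapB; apply/monoP.
suff in_gap C x y : C \in P -> x \in C -> y \in C -> (i < x < j)%N -> (i < y < j)%N.
  by move=> C x y CP xC yC; apply/idP/idP; apply: in_gap CP _ _.
move=> CP xC yC xg; have BC : B <> C by move=> BC; move: xg; apply/negP/gapB; rewrite BC.
apply: contra_notT BC => yg.
have [yi|iy|/ord_inj yi] := ltngtP y i; last by apply: (tP _ _ i); rewrite // -yi.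
  by apply/esym; apply: (@nP _ _ y i x j) => //; lia.
have [yj|jy|/ord_inj yj] := ltngtP y j; last by apply: (tP _ _ j); rewrite // -yj.
  lia.
by apply: (@nP _ _ i x j y) => //; lia.
Qed.

(** The convex hull of a block is saturated, since every block that meets the
    hull without being the given block lies in one of its gaps. *)
Lemma mono_hull P D B i j : P \in ncpart D -> B \in P -> i \in B -> j \in B ->
  (forall x, x \in B -> (i <= x <= j)%N) -> monochromatic (fun x => (i <= x <= j)%N) P.
Proof.
case/ncpartP=> _ _ tP nP BP iB jB hullB; apply/monoP.
suff in_hull C x y : C \in P -> x \in C -> y \in C -> (i <= x <= j)%N -> (i <= y <= j)%N.
  by move=> C x y CP xC yC; apply/idP/idP; apply: in_hull CP _ _.
move=> CP xC yC xg.
have [BC|BC] := eqVneq B C; first by apply: hullB; rewrite BC.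
apply: contra_neqT BC => yg.
have [xi|ix|/ord_inj xi] := ltngtP x i; [lia| |by apply: (tP _ _ i); rewrite // -xi].
have [jx|xj|/ord_inj xj] := ltngtP x j; [|lia|by apply: (tP _ _ j); rewrite // -xj].
case/nandP: yg => yg.
  by apply/esym; apply: (@nP _ _ y i x j) => //; lia.
by apply: (@nP _ _ i x j y) => //; lia.
Qed.

End Noncrossing.

(** * The Kreweras complement *)

Lemma itv_openE (v w x : nat) : (v < w)%N ->
  (x < v.+1)%N (+) (x < w)%N = (v < x < w)%N.
Proof. by case: (leqP w x); case: (leqP x v) => //; lia. Qed.

Lemma itv_closedE (u v x : nat) : (u <= v)%N ->
  (x < u)%N (+) (x < v.+1)%N = (u <= x <= v)%N.
Proof. by rewrite ltnS; case: (ltnP x u); case: (leqP x v) => //; lia. Qed.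

Section Kreweras.
Variable N : nat.
Implicit Types (B C : {set 'I_N}) (P Q : {set {set 'I_N}}) (i j k l x y : 'I_N).

Lemma NCE : NC N = ncpart setT.
Proof. by []. Qed.

Lemma NC_partition P : P \in NC N -> partition P setT.
Proof. exact: ncpart_partition. Qed.

Lemma NC_pblockP P : partition P setT ->
  (forall i j k l, (i < j < k)%N -> (k < l)%N ->
     k \in pblock P i -> l \in pblock P j -> j \in pblock P i) ->
  P \in NC N.
Proof.
move=> partP ncP; have [/eqP covP tP P0] := and3P partP.
have iP i : i \in cover P by rewrite covP inE.
rewrite NCE; apply/ncpartP; split.
- move=> B BP; apply/set0Pn; apply: contraNneq P0 => <- //.
- move=> i; rewrite inE; split=> // _.
  by exists (pblock P i); rewrite ?pblock_mem ?mem_pblock.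
- by move=> B C i BP CP iB iC; rewrite -(def_pblock tP BP iB) (def_pblock tP CP iC).
move=> B C i j k l BP CP ijk kl iB kB jC lC.
rewrite -(def_pblock tP BP iB) -(def_pblock tP CP jC).
apply/eqP; rewrite eq_pblock //; apply: (ncP i j k l) => //.
  by rewrite (def_pblock tP BP iB).
by rewrite (def_pblock tP CP jC).
Qed.

Lemma eq_partition_pblock P Q : partition P setT -> partition Q setT ->
  (forall i j, (j \in pblock P i) = (j \in pblock Q i)) -> P = Q.
Proof.
move=> partP partQ PQ.
rewrite -(equivalence_partition_pblock partP) -(equivalence_partition_pblock partQ).
by rewrite /equivalence_partition; apply: eq_imset => i; apply/setP => j; rewrite !inE PQ.
Qed.

(** The Kreweras complement. In the usual picture it lives on a second copy of
    the points, and joins two of them when no block of [P] separates them.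
    Placing the dual copy of [i] just before [i], the points between the dual
    copies of [i] and [j] are those on which [x < i] and [x < j] differ, so
    the condition is that they form a saturated set. *)
Definition kreweras P : {set {set 'I_N}} :=
  equivalence_partition
    (fun i j => monochromatic (fun x : 'I_N => (x < i)%N (+) (x < j)%N) P) setT.

(** Saturated sets are closed under symmetric difference, which gives
    transitivity. *)
Lemma krew_equiv P : {in [set: 'I_N] & &, equivalence_rel
  (fun i j => monochromatic (fun x : 'I_N => (x < i)%N (+) (x < j)%N) P)}.
Proof.
move=> i j k _ _ _; split; first by apply/monoP => *; rewrite !addbb.
have xorE (u v w : bool) : v (+) w = (u (+) v) (+) (u (+) w).
  by case: u v w => [] [] [].
move=> /monoP ij; apply/monoP/monoP => mP B x y BP xB yB.
  rewrite (xorE (x < i)%N (x < j)%N) (xorE (y < i)%N (y < j)%N).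
  by rewrite (ij B x y) // (mP B x y).
have xorE' (u v w : bool) : u (+) w = (u (+) v) (+) (v (+) w).
  by case: u v w => [] [] [].
rewrite (xorE' (x < i)%N (x < j)%N) (xorE' (y < i)%N (y < j)%N).
by rewrite (ij B x y) // (mP B x y).
Qed.

Lemma krew_partition P : partition (kreweras P) setT.
Proof. exact: equivalence_partitionP (@krew_equiv P). Qed.

Lemma krewE P i j :
  (j \in pblock (kreweras P) i) = monochromatic (fun x : 'I_N => (x < i)%N (+) (x < j)%N) P.
Proof. by rewrite (pblock_equivalence_partition (@krew_equiv P)) ?inE. Qed.

(** For [i < j < k < l] the segment from [j] to [k] is the intersection of
    those from [i] to [k] and from [j] to [l], and saturated sets are closed
    under intersection. *)
Lemma krew_NC P : kreweras P \in NC N.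
Proof.
apply: NC_pblockP (krew_partition P) _ => i j k l ijk kl.
rewrite !krewE => /monoP ik /monoP jl; apply/monoP.
have ij_jk x : (x < i)%N (+) (x < j)%N =
    ((x < i)%N (+) (x < k)%N) && ~~ ((x < j)%N (+) (x < l)%N).
  have [? ?] := andP ijk; have [xl|lx] := ltnP x l; have [xk|kx] := ltnP x k;
  have [xj|jx] := ltnP x j; have [xi|ix] := ltnP x i => //=; lia.
by move=> B x y BP xB yB; rewrite !ij_jk (ik B x y) // (jl B x y).
Qed.

(** [P] is recovered from its complement by the mirror image of the
    construction, which is why the complement is injective, hence bijective,
    on noncrossing partitions. If [i < j] lie in different blocks, some
    complementary block separates them: it is found at the end of the gap of
    the block of [i] that contains [j], or at the two ends of its hull if that
    block does not reach beyond [j]. *)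
Lemma krewK P i j : P \in NC N ->
  (j \in pblock P i) = monochromatic (fun x : 'I_N =>
    (x <= i)%N (+) (x <= j)%N) (kreweras P).
Proof.
move=> PNC; have partP := NC_partition PNC; have [/eqP covP tP _] := and3P partP.
have iP z : z \in cover P by rewrite covP inE.
apply/idP/idP => [ij|].
  apply/(monoTP _ (krew_partition P)) => x y; rewrite krewE.
  move=> /(monoTP _ partP)/(_ _ _ ij); rewrite !(leqNgt _ i) !(leqNgt _ j).
  by case: (i < x)%N; case: (i < y)%N; case: (j < x)%N; case: (j < y)%N.
wlog ij : i j / (i < j)%N => [wl|].
  have [/wl//|ji|/ord_inj ->] := ltngtP i j; last by rewrite mem_pblock iP.
  move=> H; rewrite -eq_pblock // eq_sym eq_pblock //; apply: wl => //.
  by rewrite (eq_mono _ (d := fun x : 'I_N => (x <= i)%N (+) (x <= j)%N)) // => x;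
    rewrite addbC.
move=> /(monoTP _ (krew_partition P)) mK; apply: contraT => jB.
set B := pblock P i in jB; have BP : B \in P by rewrite pblock_mem.
have iB : i \in B by rewrite mem_pblock.
(* [v] is the last element of the block before [j], and [v1] the point that
   opens the gap which contains [j]. *)
have [|v /andP[vB vj] vmax] := @arg_maxnP _ i (fun v => (v \in B) && (v < j)%N) val.
  by rewrite iB.
have iv : (i <= v)%N by apply: vmax; rewrite iB.
have v1N : (v.+1 < N)%N by apply: leq_ltn_trans vj _.
pose v1 := Ordinal v1N.
have [/existsP[w0 w0P]|noW] := boolP [exists w, (w \in B) && (j < w)%N].
  have [w /andP[wB jw] wmin] := @arg_minnP _ w0 (fun v => (v \in B) && (j < v)%N) val w0P.
  have := mK v1 w; rewrite krewE /=.
  rewrite (leq_gtF iv).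
  rewrite vj.
  rewrite (ltn_geF (ltn_trans ij jw)).
  rewrite (ltn_geF jw).
  move=> H; suff /H : monochromatic (fun x : 'I_N => (x < v.+1)%N (+) (x < w)%N) P by [].
  rewrite (eq_mono _ (d := fun x : 'I_N => (v < x < w)%N)).
    apply: (mono_gap PNC BP vB wB) => x xB; apply/negP => /andP[vx xw].
    have [xj|jx|xj] := ltngtP x j.
    - by have := leq_trans vx (vmax x _); rewrite ltnn xB xj => /(_ isT).
    - by have := leq_trans xw (wmin x _); rewrite ltnn xB jx => /(_ isT).
    - by rewrite -(ord_inj xj) xB in jB.
  by move=> x; rewrite itv_openE // (ltn_trans vj jw).
have [u uB umin] := @arg_minnP _ i (fun v => (v \in B)) val iB.
have := mK u v1; rewrite krewE /=.
rewrite (leq_gtF iv).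
rewrite vj.
rewrite [(u <= i)%N]umin //.
rewrite (leq_trans (umin _ iB) (ltnW ij)).
move=> H; suff /H : monochromatic (fun x : 'I_N => (x < u)%N (+) (x < v.+1)%N) P by [].
rewrite (eq_mono _ (d := fun x : 'I_N => (u <= x <= v)%N)).
  apply: (mono_hull PNC BP uB vB) => x xB; rewrite [(u <= x)%N]umin //=.
  apply: vmax; rewrite xB /=; have [//|jx|xj] := ltngtP x j.
    by case/existsP: noW; exists x; rewrite xB.
  by rewrite -(ord_inj xj) xB in jB.
by move=> x; rewrite itv_closedE // umin.
Qed.

Lemma krew_inj : {in NC N &, injective kreweras}.
Proof.
move=> P Q PNC QNC eqK; apply: eq_partition_pblock; rewrite ?NC_partition // => i j.
by rewrite !krewK // eqK.
Qed.

Lemma krew_onto : kreweras @: NC N = NC N.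
Proof.
apply/eqP; rewrite eqEcard card_in_imset ?leqnn ?andbT; last exact: krew_inj.
by apply/subsetP => _ /imsetP[P _ ->]; apply: krew_NC.
Qed.

(** Used to count blocks by their largest or by their smallest elements. *)
Lemma card_representatives Q (S : {set 'I_N}) : partition Q setT ->
  (forall B, B \in Q -> exists2 i, i \in B & i \in S) ->
  (forall i j, i \in S -> j \in S -> j \in pblock Q i -> i = j) -> #|Q| = #|S|.
Proof.
case/and3P=> /eqP covQ tQ _ exS uniqS.
have iQ z : z \in cover Q by rewrite covQ inE.
have -> : Q = pblock Q @: S.
  apply/setP => B; apply/idP/imsetP => [BQ|[x xS ->]]; last exact: pblock_mem.
  by have [x xB xS] := exS B BQ; exists x; rewrite ?(def_pblock tQ BQ xB).
by rewrite card_in_imset // => i j iS jS /eqP; rewrite eq_pblock // => /uniqS; apply.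
Qed.

End Kreweras.

(** A point is the largest of its block exactly when its successor is not the
    smallest of its complementary block: both say that the hull of the block
    ends at that point. The exceptions are the last point, always a largest
    one, and the first, always a smallest one. *)
Lemma card_krew N (P : {set {set 'I_N}}) : (0 < N)%N -> P \in NC N ->
  (#|P| + #|kreweras P| = N.+1)%N.
Proof.
case: N P => // n P _ PNC; have partP := NC_partition PNC.
have partK := krew_partition P.
have cover_all (Q : {set {set 'I_n.+1}}) : partition Q setT -> forall i, i \in cover Q.
  by case/and3P=> /eqP -> _ _ i; rewrite inE.
pose maxs := [set i : 'I_n.+1 | [forall j in pblock P i, (j <= i)%N]].
pose mins := [set i : 'I_n.+1 | [forall j in pblock (kreweras P) i, (i <= j)%N]].
have -> : #|P| = #|maxs|.
  apply: card_representatives => // [B BP|i j].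
    have [/eqP covP tP P0] := and3P partP.
    have /set0Pn[i0 i0B] : B != set0 by apply: contraNneq P0 => <-.
    have [i iB imax] := @arg_maxnP _ i0 (fun v => (v \in B)) val i0B.
    by exists i => //; rewrite inE (def_pblock tP BP iB); apply/forall_inP.
  rewrite !inE => /forall_inP imax /forall_inP jmax ij; apply/ord_inj/eqP.
  rewrite eqn_leq imax // jmax //; have [_ tP _] := and3P partP.
  by rewrite (same_pblock tP ij) mem_pblock cover_all.
have -> : #|kreweras P| = #|mins|.
  apply: card_representatives => // [B BP|i j].
    have [/eqP covP tP P0] := and3P partK.
    have /set0Pn[i0 i0B] : B != set0 by apply: contraNneq P0 => <-.
    have [i iB imin] := @arg_minnP _ i0 (fun v => (v \in B)) val i0B.
    by exists i => //; rewrite inE (def_pblock tP BP iB); apply/forall_inP.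
  rewrite !inE => /forall_inP imin /forall_inP jmin ij; apply/ord_inj/eqP.
  rewrite eqn_leq imin // jmin //; have [_ tP _] := and3P partK.
  by rewrite (same_pblock tP ij) mem_pblock cover_all.
rewrite -!sum1_card big_mkcond big_ord_recr /= [in X in (_ + X)%N]big_mkcond big_ord_recl /=.
have -> : ord_max \in maxs by rewrite inE; apply/forall_inP => j _; rewrite -ltnS.
have -> : ord0 \in mins by rewrite inE; apply/forall_inP.
rewrite [X in (X + _)%N]addnC addnACA -big_split (eq_bigr (fun=> 1%N)) ?sum_nat_const ?card_ord; first by lia.
move=> k _; set a := widen_ord _ k; set b := lift ord0 k.
have ab : b = a.+1 :> nat by [].
suff -> : (a \in maxs) = (b \notin mins) by case: (b \in mins).
have aB : a \in pblock P a by rewrite mem_pblock cover_all.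
rewrite !inE negb_forall_in; apply/forall_inP/exists_inP => [amax|].
  have [u uB umin] := @arg_minnP _ a (fun v => (v \in pblock P a)) val aB.
  have ua : (u <= a)%N := umin _ aB.
  exists u; last by rewrite -ltnNge ab ltnS.
  rewrite krewE (eq_mono _ (d := fun x : 'I_n.+1 => (u <= x <= a)%N)).
    apply: (mono_hull PNC _ uB aB) => [|x xB]; first by rewrite pblock_mem ?cover_all.
    by rewrite [(u <= x)%N]umin //= amax.
  by move=> x; rewrite addbC; apply: itv_closedE ua.
case=> u; rewrite krewE -ltnNge ab ltnS => /(monoTP _ partP) mu ua j ja.
have := mu a j ja; rewrite !ltnS leqnn (ltnNge a) ua /=.
by case: (leqP j a) => //= aj; rewrite (leq_gtF (leq_trans ua (ltnW aj))).
Qed.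

Lemma pblockT N (P : {set {set 'I_N}}) i : partition P setT -> pblock P i \in P.
Proof. by case/and3P=> /eqP covP _ _; rewrite pblock_mem // covP inE. Qed.

Lemma mem_pblockT N (P : {set {set 'I_N}}) i : partition P setT -> i \in pblock P i.
Proof. by case/and3P=> /eqP covP _ _; rewrite mem_pblock // covP inE. Qed.

Lemma eq_pblockT N (P : {set {set 'I_N}}) i j : partition P setT ->
  (pblock P i == pblock P j) = (j \in pblock P i).
Proof. by case/and3P=> /eqP covP tP _; rewrite eq_pblock // covP inE. Qed.

Lemma pblock_sym N (P : {set {set 'I_N}}) i j : partition P setT ->
  (j \in pblock P i) = (i \in pblock P j).
Proof. by move=> partP; rewrite -!eq_pblockT // eq_sym. Qed.

Lemma NC_cross N (P : {set {set 'I_N}}) (i j k l : 'I_N) : P \in NC N ->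
  (i < j < k)%N -> (k < l)%N -> k \in pblock P i -> l \in pblock P j ->
  j \in pblock P i.
Proof.
move=> PNC ijk kl ik jl; have partP := NC_partition PNC.
have [_ _ _ ncP] := ncpartP _ _ PNC.
have -> : pblock P i = pblock P j.
  by apply: (@ncP _ _ i j k l); rewrite ?pblockT ?mem_pblockT.
exact: mem_pblockT.
Qed.

(** Here [v] is the cyclic predecessor of [i] in its block: the gap between
    them, or the whole hull of the block when [i] is its least element, is
    saturated. In other words, the complement is the block permutation of [P]
    composed with a cyclic shift. *)
Lemma krew_pred N (P : {set {set 'I_N}}) (i : 'I_N) : P \in NC N ->
  exists2 v : 'I_N, v \in pblock P i &
    forall j : 'I_N, j = (v.+1 %% N)%N :> nat -> j \in pblock (kreweras P) i.
Proof.
move=> PNC; have partP := NC_partition PNC; have [/eqP covP tP _] := and3P partP.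
have iP z : z \in cover P by rewrite covP inE.
have N_gt0 : (0 < N)%N by apply: leq_ltn_trans (ltn_ord i).
set B := pblock P i; have BP : B \in P by rewrite pblock_mem.
have iB : i \in B by rewrite mem_pblock.
have [/existsP[v0 v0P]|no_v] := boolP [exists v, (v \in B) && (v < i)%N].
  have [v /andP[vB vi] vmax] := @arg_maxnP _ v0 (fun v => (v \in B) && (v < i)%N) val v0P.
  exists v => // j; rewrite modn_small => [jv|]; last by apply: leq_ltn_trans vi _.
  rewrite krewE (eq_mono _ (d := fun x : 'I_N => (v < x < i)%N)).
    apply: (mono_gap PNC BP vB iB) => x xB; apply/negP => /andP[vx xi].
    by have := leq_trans vx (vmax x _); rewrite ltnn xB xi => /(_ isT).
  by move=> x; rewrite jv addbC itv_openE.
have imin x : x \in B -> (i <= x)%N.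
  by move=> xB; rewrite leqNgt; apply: contra no_v => xi; apply/existsP; exists x;
    rewrite xB.
have [v vB vmax] := @arg_maxnP _ i (fun v => v \in B) val iB.
have hull : monochromatic (fun x : 'I_N => (i <= x <= v)%N) P.
  by apply: (mono_hull PNC BP iB vB) => x xB; rewrite imin //=; apply: vmax.
exists v => // j jv; rewrite krewE.
have [v1N|] := ltnP v.+1 N.
  rewrite modn_small // in jv; rewrite (eq_mono _ (d := fun x : 'I_N =>
    (i <= x <= v)%N)) //.
  by move=> x; rewrite jv itv_closedE // imin.
move=> Nv; have vN : v.+1 = N by apply/eqP; rewrite eqn_leq Nv ltn_ord.
rewrite vN modnn in jv.
apply/monoP => C x y CP xC yC; have /monoP/(_ C x y CP xC yC) := hull.
have xv : (x <= v)%N by rewrite -ltnS vN.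
have yv : (y <= v)%N by rewrite -ltnS vN.
by rewrite xv yv !andbT jv !ltn0 !addbF !(leqNgt i) => /negb_inj.
Qed.

(** A half-open interval with ends [i] and [j] contains only one of them, so it
    cannot be saturated if they are in the same block. *)
Lemma krew_block_inj N (P : {set {set 'I_N}}) (i j : 'I_N) : partition P setT ->
  j \in pblock P i -> j \in pblock (kreweras P) i -> i = j.
Proof.
move=> partP ij; rewrite krewE => /(monoTP _ partP)/(_ _ _ ij).
by rewrite !ltnn addbF /= => ijji; apply/ord_inj; lia.
Qed.

(** * The graph of a partition and its components *)

Section Graph.
Variable n : nat.
Local Notation pt := 'I_(2 * n).
Implicit Types (P Q : {set {set pt}}) (B C : {set pt}) (i j x y : pt).
Implicit Types (k l m : 'I_n) (S : {set 'I_n}).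

Lemma edge_of_subproof i : (i./2 < n)%N.
Proof. by have := ltn_ord i; lia. Qed.
(** The graph has one edge per consecutive pair of points, so the points are
    the ends of the edges. *)
Definition edge_of i : 'I_n := Ordinal (edge_of_subproof i).

Lemma edge_of_odd_pt k : edge_of (odd_pt k) = k.
Proof. by apply: ord_inj => /=; lia. Qed.
Lemma edge_of_even_pt k : edge_of (even_pt k) = k.
Proof. by apply: ord_inj => /=; lia. Qed.
Lemma edge_ofK i : i = if odd i then even_pt (edge_of i) else odd_pt (edge_of i).
Proof. by apply: ord_inj; case: ifP => /=; lia. Qed.
Lemma ltn_odd_pt i k : (i < odd_pt k)%N = (edge_of i < k)%N.
Proof. by rewrite /=; lia. Qed.
Lemma odd_odd_pt k : odd (odd_pt k) = false.
Proof. by rewrite /=; lia. Qed.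
Lemma odd_even_pt k : odd (even_pt k) = true.
Proof. by rewrite /=; lia. Qed.

(** Colouring the first end of every edge, by whether the edge belongs to [S],
    determines the colour of its second end; this makes sense for partitions
    of any set of points, as restrictions to components require. *)
Definition bipartite P :=
  [exists S : {set 'I_n}, monochromatic (fun i => (edge_of i \in S) (+) odd i) P].

(** Connectedness without paths: a set of edges that no block leaves contains
    all edges with an end in the support of [P], or none. Like [bipartite] it
    makes sense for partitions of any set of points. *)
Definition connected P :=
  [forall S : {set 'I_n}, monochromatic (fun i => edge_of i \in S) P ==>
     [forall i in cover P, forall j in cover P,
        (edge_of i \in S) == (edge_of j \in S)]].

Lemma connP P : reflect
  (forall S, monochromatic (fun i => edge_of i \in S) P ->
     forall i j, i \in cover P -> j \in cover P -> (edge_of i \in S) = (edge_of j \in S))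
  (connected P).
Proof.
apply: (iffP forallP) => cP S; first by
  move=> mS i j iP jP; have /implyP/(_ mS)/forall_inP/(_ i iP)/forall_inP/(_ j jP)/eqP := cP S.
apply/implyP => mS; apply/forall_inP => i iP; apply/forall_inP => j jP.
by apply/eqP/cP.
Qed.

Lemma connTP P : partition P setT -> reflect
  (forall S, monochromatic (fun i => edge_of i \in S) P -> forall k l, (k \in S) =
    (l \in S))
  (connected P).
Proof.
case/and3P=> /eqP covP _ _; apply: (iffP (connP P)) => cP S mS.
  by move=> k l; rewrite -[k]edge_of_odd_pt -[l]edge_of_odd_pt; apply: cP;
    rewrite ?covP ?inE.
by move=> i j _ _; apply: cP.
Qed.

(** Both conditions on the graph are expressed by colourings of points that
    are constant on blocks: a set of vertices closed under adjacency is a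
    saturated union of edges, and a proper 2-colouring of the vertices colours
    the points. *)
Lemma NCXE P : (P \in NCX n) = [&& P \in NC (2 * n), connected P & bipartite P].
Proof.
rewrite inE; case: (boolP (P \in NC _)) => //= PNC; have partP := NC_partition PNC.
have [/eqP covP tP P0] := and3P partP.
have iP i : i \in cover P by rewrite covP inE.
congr (_ && _).
  apply/forall_inP/(connTP partP) => [cP S mS k l|cP V VP].
    have clS : closed (graph_adj P) [set B : {set pt} | [exists i :
      pt in B, edge_of i \in S]].
      suff adjS V W : graph_adj P V W ->
          [exists i in V, edge_of i \in S] -> [exists i in W, edge_of i \in S].
        move=> V W VW; rewrite !inE; apply/idP/idP; apply: adjS; first exact: VW.
        by move: VW => /existsP[m mVW]; apply/existsP; exists m; rewrite orbC.
      case/existsP=> m mVW /existsP[i /andP[iV iS]].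
      have sameS x y : y \in pblock P x -> (edge_of x \in S) = (edge_of y \in S).
        exact: (elimT (monoTP _ partP) mS).
      case/orP: mVW => /eqP[eV eW]; apply/existsP.
        exists (even_pt m); rewrite -eW mem_pblock iP edge_of_even_pt.
        by rewrite -[m](edge_of_odd_pt m) (@sameS _ i) // eV.
      exists (odd_pt m); rewrite -eV mem_pblock iP edge_of_odd_pt.
      by rewrite -[m](edge_of_even_pt m) (@sameS _ i) // eW.
    have mem_blk m : (m \in S) =
        (pblock P (odd_pt m) \in [set B : {set pt} | [exists i :
          pt in B, edge_of i \in S]]).
      rewrite inE; apply/idP/existsP => [mS'|[x /andP[xm xS]]].
        by exists (odd_pt m); rewrite mem_pblock iP edge_of_odd_pt.
      by rewrite -[m]edge_of_odd_pt (monoTP _ partP mS _ _ xm).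
    rewrite !mem_blk; apply: (closed_connect clS).
    by apply: (forall_inP (cP _ _)); rewrite pblock_mem.
  apply/forall_inP => W WP.
  have [i iV] : exists i, i \in V by apply/set0Pn; apply: contraNneq P0 => <-.
  have [j jW] : exists j, j \in W by apply/set0Pn; apply: contraNneq P0 => <-.
  pose S := [set m | connect (graph_adj P) V (pblock P (odd_pt m))].
  have adj m : graph_adj P (pblock P (odd_pt m)) (pblock P (even_pt m)).
    by apply/existsP; exists m; rewrite eqxx.
  have adjC m : graph_adj P (pblock P (even_pt m)) (pblock P (odd_pt m)).
    by apply/existsP; exists m; rewrite eqxx orbT.
  have SE x : (edge_of x \in S) = connect (graph_adj P) V (pblock P x).
    rewrite inE {2}[x]edge_ofK; case: (odd x) => //.
    by apply/idP/idP => /connect_trans; apply; apply: connect1.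
  have mS : monochromatic (fun x => edge_of x \in S) P.
    by apply/(monoTP _ partP) => x y xy; rewrite !SE (same_pblock tP xy).
  have := cP S mS (edge_of i) (edge_of j).
  by rewrite !SE (def_pblock tP VP iV) (def_pblock tP WP jW) connect0.
apply/existsP/existsP => [[S /forallP SP]|[S /(monoTP _ partP) mS]].
  exists [set m | pblock P (odd_pt m) \in S]; apply/(monoTP _ partP) => x y xy.
  have SE z : (edge_of z \in [set m | pblock P (odd_pt m) \in S]) (+) odd z
      = (pblock P z \in S).
    rewrite inE {3}[z]edge_ofK; case: (odd z); rewrite ?addbF // addbT.
    by have := SP (edge_of z); rewrite /=; case: (pblock P (odd_pt _) \in S);
      case: (pblock P (even_pt _) \in S).
  by rewrite !SE (same_pblock tP xy).
pose c i := (edge_of i \in S) (+) odd i.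
exists [set B : {set pt} | [exists i : pt in B, c i]]; apply/forallP => m; rewrite /= !inE.
have cE x : [exists i in pblock P x, c i] = c x.
  apply/existsP/idP => [[y /andP[xy]]|cx]; first by rewrite /c (mS _ _ xy).
  by exists x; rewrite mem_pblock iP.
rewrite !cE /c odd_odd_pt odd_even_pt edge_of_odd_pt edge_of_even_pt.
by case: (m \in S).
Qed.

(** The partition of the edges into connected components, two edges being in
    the same one when no saturated set of edges separates them. *)
Definition components P : {set {set 'I_n}} :=
  equivalence_partition
    (fun k l => [forall S : {set 'I_n}, monochromatic (fun i =>
      edge_of i \in S) P ==> ((k \in S) == (l \in S))])
    setT.

Lemma comp_equiv P : {in [set: 'I_n] & &, equivalence_rel
  (fun k l => [forall S : {set 'I_n}, monochromatic (fun i =>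
    edge_of i \in S) P ==> ((k \in S) == (l \in S))])}.
Proof.
move=> k l m _ _ _; split; first by apply/forallP => S; rewrite eqxx implybT.
move=> /forallP kl; apply: eq_forallb => S.
by case: (monochromatic _ _) (kl S) => //= /eqP ->.
Qed.

Lemma comp_partition P : partition (components P) setT.
Proof. exact: equivalence_partitionP (@comp_equiv P). Qed.

Lemma compP P k l : reflect
  (forall S, monochromatic (fun i => edge_of i \in S) P -> (k \in S) = (l \in S))
  (l \in pblock (components P) k).
Proof.
rewrite (pblock_equivalence_partition (@comp_equiv P)) ?inE //.
by apply: (iffP forallP) => kl S; [move=> mS; have /implyP/(_ mS)/eqP := kl S
  | apply/implyP => /kl ->].
Qed.

Lemma mono_comp (I : eqType) (c : 'I_n -> I) P : partition P setT ->
  monochromatic c (components P) -> monochromatic (fun i => c (edge_of i)) P.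
Proof.
move=> partP /(monoTP _ (comp_partition P)) mc; apply/(monoTP _ partP) => i j ij.
by apply: mc; apply/compP => S /(monoTP _ partP)/(_ _ _ ij).
Qed.

Lemma pblock_comp_mono P k : partition P setT ->
  monochromatic (fun i => edge_of i \in pblock (components P) k) P.
Proof.
move=> partP; apply: (@mono_comp _ (fun m => m \in pblock (components P) k)) => //.
apply/(monoTP _ (comp_partition P)) => l m lm; have [/eqP cov tP _] :=
  and3P (comp_partition P).
have kc : k \in cover (components P) by rewrite cov inE.
by rewrite -!(eq_pblock _ tP kc) (same_pblock tP lm).
Qed.

End Graph.

Section Duality.
Variable n : nat.
Local Notation pt := 'I_(2 * n).
Implicit Types (P Q : {set {set pt}}) (B C : {set pt}) (i j x y : pt).
Implicit Types (k l m : 'I_n) (S : {set 'I_n}).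

(** A component is connected: any nontrivial splitting of its edges is crossed
    by some block. *)
Lemma comp_cut P m (a : pred 'I_n) k l : partition P setT ->
  k \in pblock (components P) m -> l \in pblock (components P) m -> a k -> ~~ a l ->
  exists x y, [/\ y \in pblock P x, edge_of x \in pblock (components P) m,
                  edge_of y \in pblock (components P) m, a (edge_of x) & ~~ a (edge_of y)].
Proof.
move=> partP kV lV ak al; set V := pblock (components P) m.
have [/existsP[x /existsP[y /and5P[xy xV yV ax ay]]]|no_cut] :=
    boolP [exists x : pt, exists y : pt, [&& y \in pblock P x, edge_of x \in V,
             edge_of y \in V, a (edge_of x) & ~~ a (edge_of y)]].
  by exists x, y.
have no_cutP x y : y \in pblock P x -> edge_of x \in V -> edge_of y \in V ->
    a (edge_of x) -> a (edge_of y).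
  move=> xy xV yV ax; apply: contraNT no_cut => ay; apply/existsP; exists x.
  by apply/existsP; exists y; apply/and5P.
have mS : monochromatic (fun x => edge_of x \in [set w in V | a w]) P.
  apply/(monoTP _ partP) => x y xy; rewrite !inE.
  have eqV := elimT (monoTP _ partP) (pblock_comp_mono m partP) _ _ xy.
  rewrite -/V in eqV; rewrite eqV; case: (boolP (_ \in V)) => //= yV.
  apply/idP/idP; apply: no_cutP => //; rewrite ?eqV //.
  by rewrite pblock_sym.
have kl : l \in pblock (components P) k.
  have [_ tC _] := and3P (comp_partition P).
  by rewrite (same_pblock tC kV).
by have := elimT (compP _ _ _) kl _ mS; rewrite !inE kV lV ak (negPf al).
Qed.

(** If two components [V] and [W] crossed, splitting [V] at two points of [W]
    would give a block of [P] with ends [p] and [q] on both sides of a point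
    of [W]. Splitting [W] at [p] and [q] then gives a block that crosses it.
    *)
Lemma comp_NC P : P \in NC (2 * n) -> components P \in NC n.
Proof.
move=> PNC; have partP := NC_partition PNC; have partC := comp_partition P.
apply: NC_pblockP (comp_partition P) _ => i j k l /andP[ij jk] kl ik jl.
apply: contraT => nij.
set V := pblock (components P) i in ik nij *; set W := pblock (components P) j in jl *.
have iV : i \in V by apply: mem_pblockT.
have jW : j \in W by apply: mem_pblockT.
have VW w : w \in V -> w \in W -> False.
  rewrite -!eq_pblockT // => /eqP Vw /eqP Ww; case/negP: nij.
  by rewrite -eq_pblockT // Vw Ww.
have edge_lt (x y : pt) : (edge_of x < edge_of y)%N -> (x < y)%N.
  by rewrite /=; clear; lia.
have same_edge x y : y \in pblock P x -> edge_of x \in V -> edge_of y \in W -> False.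
  move=> xy xV; apply: VW.
  by have := elimT (monoTP _ partP) (pblock_comp_mono i partP) _ _ xy; rewrite -/V xV.
(* Used twice, since the end [q] of the block may lie on either side of the
   crossing. *)
have absurd p q u v : q \in pblock P p -> edge_of p \in V -> edge_of q \in V ->
    u \in W -> v \in W -> (edge_of p < u < edge_of q)%N ->
    (v < edge_of p)%N || (edge_of q < v)%N -> False.
  move=> pq pV qV uW vW uin vout.
  have [|x [y [xy xW yW /andP[px xq]]]] :=
      comp_cut (a := fun w : 'I_n => (edge_of p < w < edge_of q)%N) partP uW vW uin _.
    by case/orP: vout => h; rewrite negb_and -!leqNgt (ltnW h) ?orbT.
  have neW w w' : w \in V -> w' \in W -> w <> w' :> nat.
    by move=> wV w'W /ord_inj ww'; apply: (VW w); rewrite // ww'.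
  rewrite negb_and -!leqNgt => /orP[yp|qy].
    have {}yp : (edge_of y < edge_of p)%N.
      by rewrite ltn_neqAle yp andbT eq_sym; apply/eqP; apply: neW.
    have xy' : x \in pblock P y by rewrite pblock_sym.
    have py := NC_cross PNC (introT andP (conj (edge_lt _ _ yp) (edge_lt _ _ px)))
                (edge_lt _ _ xq) xy' pq.
    by apply: (same_edge p y); rewrite // pblock_sym.
  have {}qy : (edge_of q < edge_of y)%N.
    by rewrite ltn_neqAle qy andbT; apply/eqP; apply: neW.
  have px' := NC_cross PNC (introT andP (conj (edge_lt _ _ px) (edge_lt _ _ xq)))
                (edge_lt _ _ qy) pq xy.
  exact: (same_edge p x).
have [||x [y [xy xV yV /andP[jx xl]]]] :=
    comp_cut (a := fun w : 'I_n => (j < w < l)%N) partP ik iV.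
- by rewrite jk kl.
- by rewrite negb_and -!leqNgt (ltnW ij).
rewrite negb_and -!leqNgt => /orP[yj|ly]; exfalso.
  have {}yj : (edge_of y < j)%N.
    rewrite ltn_neqAle yj andbT; apply/eqP => /ord_inj eqj.
    by apply: (VW j); rewrite // -eqj.
  apply: (@absurd y x j l) => //; first by rewrite pblock_sym.
    by rewrite yj.
  by rewrite xl orbT.
have {}ly : (l < edge_of y)%N.
  rewrite ltn_neqAle ly andbT; apply/eqP => /ord_inj eqj.
  by apply: (VW l); rewrite // eqj.
apply: (@absurd x y l j) => //; first by rewrite xl.
by rewrite jx.
Qed.

(** Two even-valued points in the same complementary block bound a saturated
    interval made of whole edges, hence a separation. Conversely, if there are
    several components, one of them does not contain the first edge; its hull
    is saturated because components do not cross, and the even-valued points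
    at its two ends, in the cyclic order, are distinct and in the same
    complementary block. *)
Lemma conn_krew P : P \in NC (2 * n) -> reflect
  (forall k l, odd_pt l \in pblock (kreweras P) (odd_pt k) -> k = l) (connected P).
Proof.
move=> PNC; have partP := NC_partition PNC; have partC := comp_partition P.
have same_krew k l : (odd_pt l \in pblock (kreweras P) (odd_pt k)) =
    monochromatic (fun x => (edge_of x < k)%N (+) (edge_of x < l)%N) P.
  by rewrite krewE; apply: eq_mono => x; rewrite !ltn_odd_pt.
apply: (iffP idP) => [/(connTP partP) cP k l|krewP].
  rewrite same_krew => kl; apply/ord_inj.
  have := cP [set m : 'I_n | (m < k)%N (+) (m < l)%N] _ k l.
  rewrite (eq_mono _ (d := fun x => (edge_of x < k)%N (+) (edge_of x < l)%N)) => [|x].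
    by move=> /(_ kl); rewrite !inE !ltnn addbF /=; clear; lia.
  by rewrite inE.
apply/(connTP partP) => S mS.
suff all_same m : forall l, l \in pblock (components P) m.
  by move=> k l; apply: (elimT (compP _ _ _) (all_same k l)).
have n_gt0 : (0 < n)%N by apply: leq_ltn_trans (ltn_ord m).
pose o := Ordinal n_gt0.
suff with0 l : l \in pblock (components P) o.
  by move=> l; rewrite -eq_pblockT // -(eqP (etrans (eq_pblockT o m partC) (with0 m))) eq_pblockT.
apply: contraT => l0; set V := pblock (components P) l.
have lV : l \in V by apply: mem_pblockT.
have oV : o \notin V by rewrite pblock_sym.
have [u uV umin] := @arg_minnP _ l (fun v => v \in V) val lV.
have [w wV wmax] := @arg_maxnP _ l (fun v => v \in V) val lV.
have hull : monochromatic (fun x => (u <= edge_of x <= w)%N) P.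
  apply: (@mono_comp _ _ (fun m : 'I_n => (u <= m <= w)%N)) => //.
  apply: (mono_hull (comp_NC PNC) (pblockT l partC) uV wV) => x xV.
  by rewrite [(u <= x)%N]umin //=; apply: wmax.
have uw : (u <= w)%N by apply: umin.
have [w1n|nw1] := ltnP w.+1 n.
  have := krewP u (Ordinal w1n); rewrite same_krew /=.
  rewrite (eq_mono _ (d := fun x => (u <= edge_of x <= w)%N)) =>
    [/(_ hull)/(congr1 val)/=|x].
    by move=> uw1; move: uw; rewrite uw1 ltnn.
  exact: itv_closedE.
have := krewP o u; rewrite same_krew /=.
have -> : monochromatic (fun x => (edge_of x < 0)%N (+) (edge_of x < u)%N) P.
  apply/monoP => B x y BP xB yB; have := elimT (monoP _ _) hull B x y BP xB yB.
  have le_w (z : pt) : (edge_of z <= w)%N.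
    by rewrite -ltnS; apply: leq_trans nw1; apply: ltn_ord.
  by rewrite !le_w !andbT !ltn0 !(leqNgt u) => /negb_inj.
by move=> /(_ isT) ou; rewrite ou uV in oV.
Qed.

End Duality.

(** * Duality between the two classes of partitions *)

Section Bipartite.
Variable n : nat.
Local Notation pt := 'I_(2 * n).
Implicit Types (P Q : {set {set pt}}) (B C : {set pt}) (i j x y : pt).
Implicit Types (k l m : 'I_n) (S : {set 'I_n}).

(** A complementary block [B] without even-valued points is a face of the
    planar graph, and going around it the colour changes at each step.
    Concretely, sending [i] to the successor of the cyclic predecessor of [i]
    in its block of [P] is an injection of [B] into itself which exchanges the
    two colours. *)
Lemma bip_face P S B : P \in NC (2 * n) ->
  monochromatic (fun i => (edge_of i \in S) (+) odd i) P ->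
  B \in kreweras P -> (forall k, odd_pt k \notin B) -> ~~ odd #|B|.
Proof.
move=> PNC; have partP := NC_partition PNC; have partK := krew_partition P.
set c := fun _ => _; move=> /(monoTP _ partP) mc BK noB.
have [_ tK _] := and3P partK.
have oddB x : x \in B -> odd x.
  move=> xB; apply: contraT => xe; have xE := edge_ofK x.
  by rewrite (negPf xe) in xE; have := noB (edge_of x); rewrite -xE xB.
have next i : exists j, i \in B ->
    [/\ j \in B, c j = ~~ c i & exists2 v, v \in pblock P i & j = v.+1 :> nat].
  have [iB|] := boolP (i \in B); last by exists i.
  have [v iv krewv] := krew_pred i PNC.
  have jN : (v.+1 %% (2 * n) < 2 * n)%N.
    by rewrite ltn_mod; apply: leq_ltn_trans (ltn_ord i).
  pose j := Ordinal jN; exists j => _.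
  have jB : j \in B by rewrite -(def_pblock tK BK iB) krewv.
  have jv : j = v.+1 :> nat.
    rewrite /= modn_small // ltn_neqAle ltn_ord andbT; apply/eqP => v1.
    by have := oddB j jB; rewrite /= v1 modnn.
  split=> //; last by exists v.
  rewrite (mc _ _ iv) /c; have := oddB j jB; rewrite jv /= => ve.
  have -> : edge_of j = edge_of v by apply/ord_inj; change (j./2 = v./2); rewrite jv;
    clear -ve; lia.
  by rewrite (negPf ve) addbT addbF.
have [f fP] := fin_all_exists next.
have f_inj : {in B &, injective f}.
  move=> i j iB jB eqf; have [_ _ [v iv fv]] := fP i iB; have [_ _ [w jw fw]] := fP j jB.
  have vw : v = w by apply/ord_inj; move: fv; rewrite eqf fw => -[].
  apply: (krew_block_inj partP); last by rewrite (def_pblock tK BK iB).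
  by rewrite -eq_pblockT // (eqP (etrans (eq_pblockT i v partP) iv)) vw eq_sym eq_pblockT.
(* [f] exchanges the colours, so neither colour class is larger than the
   other. *)
have half b : (#|[set i in B | c i == b]| <= #|[set i in B | c i == ~~ b]|)%N.
  rewrite -(card_in_imset (f := f)); last first.
    by move=> i j; rewrite !inE => /andP[iB _] /andP[jB _]; apply: f_inj.
  apply/subset_leq_card/subsetP => _ /imsetP[x /setIdP[xB /eqP cx] ->].
  by have [fB cf _] := fP x xB; rewrite inE fB cf cx eqxx.
have -> : #|B| = (#|[set i in B | c i == true]| + #|[set i in B | c i == false]|)%N.
  rewrite -(cardsID [set i | c i] B); congr (_ + _)%N; apply: eq_card => i; rewrite !inE.
    by rewrite eqb_id.
  by rewrite andbC eqbF_neg.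
have -> : #|[set i in B | c i == true]| = #|[set i in B | c i == false]|.
  by apply/eqP; rewrite eqn_leq (half true) (half false).
by rewrite addnn odd_double.
Qed.

Lemma odd_sum_even (T : finType) (A : {pred T}) (F : T -> nat) :
  (forall t, t \in A -> ~~ odd (F t)) -> ~~ odd (\sum_(t in A) F t)%N.
Proof.
move=> evF; elim/big_ind: _ => // u v; first by rewrite oddD => /negPf-> /negPf->.
Qed.

(** Conversely a colouring is built by prescribing at which points [y] the
    colour changes between the predecessor of [y] and [y]. It has to change at
    odd values of [y]; at an even value it is adjusted so that the number of
    changes in the complementary block of [y], where [y] is the only even
    value, becomes even. Every complementary block then has an even number of
    changes, so the colours agree at two points [i] and [j] of a block, since
    the interval between them is a union of complementary blocks. *)
Lemma face_bip P : P \in NC (2 * n) ->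
  (forall k l, odd_pt l \in pblock (kreweras P) (odd_pt k) -> k = l) ->
  (forall B, B \in kreweras P -> (forall k, odd_pt k \notin B) -> ~~ odd #|B|) ->
  bipartite P.
Proof.
move=> PNC uniqK evenK; have partP := NC_partition PNC; have partK := krew_partition P.
have [/eqP covK tK _] := and3P partK.
(* Whether the colour changes at [y]: at an even-valued [y] this is the parity
   of the other points of its complementary block, all of which are changes. *)
pose d (y : pt) := odd y || ~~ odd #|pblock (kreweras P) y|.
have evend W : W \in kreweras P -> ~~ odd (\sum_(y in W) d y).
  move=> WK; have dE y : y \in W -> d y = odd y || ~~ odd #|W|.
    by move=> yW; rewrite /d (def_pblock tK WK yW).
  have [evW|oddW] := boolP (~~ odd #|W|).
    rewrite (eq_bigr (fun=> 1%N)) ?sum1_card // => y yW.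
    by rewrite dE // evW orbT.
  have /existsP[k kW] : [exists k, odd_pt k \in W].
    by apply: contraR oddW; rewrite negb_exists => /forallP noW; apply: evenK.
  have W_uniq y : y \in W -> y != odd_pt k -> odd y.
    move=> yW; apply: contraR => ye; have yE := edge_ofK y; rewrite (negPf ye) in yE.
    rewrite yE; apply/eqP; congr odd_pt; apply: esym; apply: uniqK.
    by rewrite (def_pblock tK WK kW) -yE.
  rewrite (eq_bigr (fun y => (y != odd_pt k : nat))); last first.
    move=> y yW; rewrite dE // (negPf oddW) orbF; congr nat_of_bool.
    have [->|] := eqVneq y (odd_pt k); first exact: odd_odd_pt.
    by move=> /(W_uniq y yW) ->.
  rewrite (bigD1 (odd_pt k)) //= eqxx add0n.
  rewrite (eq_bigr (fun=> 1%N)) => [|y /andP[_ ->] //].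
  rewrite (eq_bigl (mem (W :\ odd_pt k))) => [|y]; last by rewrite /= !inE andbC.
  by move: oddW; rewrite negbK sum1_card (cardsD1 (odd_pt k)) kW.
pose sum_upto x := (\sum_(y : pt | (y <= x)%N) d y)%N.
apply/existsP; exists [set k | odd (sum_upto (odd_pt k))].
have colorE i : (edge_of i \in [set k | odd (sum_upto (odd_pt k))]) (+) odd i
    = odd (sum_upto i).
  rewrite inE {3}(edge_ofK i); case: (boolP (odd i)) => oi; last first.
    by rewrite addbF {1}(edge_ofK i) (negPf oi) !edge_of_odd_pt.
  rewrite addbT [sum_upto (even_pt _)](bigD1 (even_pt (edge_of i))) //= {1}/d odd_even_pt /=.
  congr (~~ odd _); apply: eq_bigl => y; rewrite -val_eqE /=; clear; lia.
apply/(monoTP _ partP) => i j ij; rewrite !colorE.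
suff : ~~ odd (sum_upto i + sum_upto j).
  by rewrite oddD; case: (odd (sum_upto i)); case: (odd (sum_upto j)).
rewrite /sum_upto !(big_mkcond (fun y : pt => (y <= _)%N)) -big_split /=.
rewrite (eq_bigl (fun y => y \in cover (kreweras P))) => [|y]; last by rewrite covK inE.
rewrite big_trivIset //; apply: odd_sum_even => W WK.
have := elimT (monoP _ _) (etrans (esym (krewK i j PNC)) ij) W.
pose a (y : pt) := (y <= i)%N (+) (y <= j)%N; move=> aW.
have [/existsP[w /andP[wW aw]]|noa] := boolP [exists w in W, a w].
  rewrite (eq_bigr (fun y => d y : nat)) ?evend // => y yW.
  have : a y by rewrite /a (aW y w WK yW wW).
  by rewrite /a; case: ifP; case: ifP => //= *; rewrite ?addn0.
apply: odd_sum_even => y yW.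
have : ~~ a y by apply: contra noa => ay; apply/existsP; exists y; rewrite yW.
by rewrite /a; case: ifP; case: ifP => //= *; rewrite addnn odd_double.
Qed.

(** The blocks [B_i] in the definition can only be the blocks of the even-
    valued points. *)
Lemma NCYP P : reflect
  [/\ P \in NC (2 * n),
      forall k l, odd_pt l \in pblock P (odd_pt k) -> k = l
    & forall B, B \in P -> (forall k, odd_pt k \notin B) -> ~~ odd #|B|]
  (P \in NCY n).
Proof.
apply: (iffP idP).
  rewrite inE => /andP[PNC /existsP[b /existsP[E /and5P[/eqP PE injb disj /forallP bP evE]]]].
  have partP := NC_partition PNC; have [_ tP _] := and3P partP.
  have bE k : pblock P (odd_pt k) = b k.
    by apply: def_pblock (bP k) => //; rewrite PE inE imset_f.
  split=> // [k l|B].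
    by rewrite -eq_pblockT // !bE => /eqP; apply: (injectiveP _ injb).
  rewrite PE inE => /orP[/imsetP[k _ ->]|BE _]; last exact: (forall_inP evE).
  by move=> /(_ k); rewrite bP.
case=> PNC uniqP evP; rewrite inE PNC /=; have partP := NC_partition PNC.
have [_ tP _] := and3P partP.
pose b := [ffun k => pblock P (odd_pt k)].
apply/existsP; exists b; apply/existsP; exists (P :\: [set b k | k : 'I_n]).
apply/and5P; split.
- apply/eqP/setP => B; rewrite in_setU in_setD; case: (boolP (B \in imset _ _)) => //=.
  by case/imsetP=> k _ ->; rewrite ffunE pblockT.
- apply/injectiveP => k l; rewrite !ffunE => /eqP; rewrite eq_pblockT //.
  exact: uniqP.
- rewrite -setI_eq0; apply/eqP/setP => B; rewrite !in_setI in_setD in_set0.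
  by case: (B \in imset _ _).
- by apply/forallP => k; rewrite ffunE mem_pblockT.
apply/forall_inP => B; rewrite in_setD => /andP[nB BP]; apply: evP => // k.
apply: contra nB => kB; apply/imsetP; exists k => //.
by rewrite ffunE (def_pblock tP BP kB).
Qed.

Lemma krew_NCX : @kreweras (2 * n) @: NCX n = NCY n.
Proof.
have NCX_NCY P : P \in NC (2 * n) -> (P \in NCX n) = (kreweras P \in NCY n).
  move=> PNC; rewrite NCXE PNC /=; apply/andP/NCYP => [[cP bP]|[_ uniqK evK]].
    split; [exact: krew_NC | exact/(conn_krew PNC) | move=> B BK noB].
    by case/existsP: bP => S mS; apply: bip_face mS BK noB.
  by split; [apply/(conn_krew PNC) | apply: face_bip].
apply/setP => Q; apply/imsetP/idP => [[P PX ->]|QY].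
  by rewrite -NCX_NCY //; move: PX; rewrite NCXE => /and3P[].
have [QNC _ _] := NCYP _ QY; move: QNC; rewrite -krew_onto => /imsetP[P PNC QE].
by exists P; rewrite // NCX_NCY -?QE.
Qed.

Lemma sum_NCX_NCY (R : pzRingType) (lam : R) : (0 < n)%N ->
  \sum_(P in NCX n) lam ^+ #|P| = \sum_(P in NCY n) lam ^+ (2 * n + 1 - #|P|)%N.
Proof.
move=> n_gt0; have X_NC P : P \in NCX n -> P \in NC (2 * n) by rewrite NCXE => /and3P[].
rewrite -krew_NCX big_imset => [|P Q /X_NC PNC /X_NC QNC]; last exact: krew_inj.
apply: eq_bigr => P /X_NC PNC; congr (_ ^+ _).
by rewrite addn1 -(card_krew _ PNC) ?addnK // muln_gt0.
Qed.

End Bipartite.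

(** * Relabelling and gluing noncrossing partitions *)

Section Relabel.
Variables (m N : nat) (h : 'I_m -> 'I_N).
Hypothesis h_lt : forall i j : 'I_m, (h i < h j)%N = (i < j)%N.
Implicit Types (P : {set {set 'I_m}}) (Q : {set {set 'I_N}}).

Lemma relabel_inj : injective h.
Proof.
move=> i j hij; apply/ord_inj; have := h_lt i j; have := h_lt j i.
by rewrite hij ltnn; clear; lia.
Qed.

Definition push P : {set {set 'I_N}} := [set h @: B | B : {set 'I_m} in P].

Lemma push_inj : injective push.
Proof. by apply: imset_inj; apply: imset_inj; apply: relabel_inj. Qed.

Lemma card_push P : #|push P| = #|P|.
Proof. by rewrite card_imset //; apply: imset_inj; apply: relabel_inj. Qed.

Lemma mono_push (I : eqType) (c : 'I_N -> I) P :
  monochromatic c (push P) = monochromatic (c \o h) P.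
Proof.
apply/monoP/monoP => mP B.
  by move=> i j BP iB jB; apply: (mP (h @: B)); rewrite ?imset_f.
by move=> _ _ /imsetP[C CP ->] /imsetP[x xC ->] /imsetP[y yC ->]; apply: mP CP xC yC.
Qed.

Lemma push_ncpart : push @: NC m = ncpart (h @: setT).
Proof.
have h_inj := relabel_inj; apply/setP => Q; apply/imsetP/idP => [[P PNC ->]|QNC].
  have [neP covP tP nP] := ncpartP _ _ PNC; apply/ncpartP; split.
  - by move=> _ /imsetP[C /neP[x xC] ->]; exists (h x); rewrite imset_f.
  - move=> y; split=> [/imsetP[x _ ->]|[_ /imsetP[C CP ->] /imsetP[x xC ->]]].
      have [C CP xC] := (covP x).1 (in_setT x).
      by exists (h @: C); rewrite imset_f.
    by rewrite imset_f ?inE.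
  - move=> _ _ y /imsetP[B BP ->] /imsetP[C CP ->] /imsetP[x xB ->].
    by rewrite mem_imset // => xC; rewrite (tP B C x).
  move=> _ _ i j k l /imsetP[B BP ->] /imsetP[C CP ->] ijk kl.
  move=> /imsetP[i' iB iE] /imsetP[k' kB kE] /imsetP[j' jC jE] /imsetP[l' lC lE].
  rewrite iE jE kE lE !h_lt in ijk kl.
  by rewrite (nP B C i' j' k' l').
have [neQ covQ tQ nQ] := ncpartP _ _ QNC.
have CD C : C \in Q -> h @: (h @^-1: C) = C.
  move=> CQ; apply/setP => y; apply/imsetP/idP => [[x + ->]|yC]; first by rewrite inE.
  have /imsetP[x _ yE] : y \in h @: setT by apply/covQ; exists C.
  by exists x; rewrite // inE -yE.
exists [set h @^-1: (C : {set 'I_N}) | C : {set 'I_N} in Q]; last first.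
  rewrite /push -imset_comp -[LHS]imset_id; apply: eq_in_imset => C CQ.
  by rewrite /= CD.
rewrite NCE; apply/ncpartP; split.
- move=> _ /imsetP[C CQ ->]; have [y] := neQ C CQ; rewrite -{1}(CD C CQ).
  by move=> /imsetP[x xC _]; exists x.
- move=> x; rewrite in_setT; split=> // _; have hx :
  h x \in h @: setT by rewrite imset_f ?inE.
  have [C CQ xC] := (covQ (h x)).1 hx.
  by exists (h @^-1: C); [apply/imsetP; exists C | rewrite inE].
- by move=> _ _ x /imsetP[B BQ ->] /imsetP[C CQ ->]; rewrite !inE => xB xC;
  rewrite (tQ B C (h x)).
move=> _ _ i j k l /imsetP[B BQ ->] /imsetP[C CQ ->]; rewrite -!h_lt !inE =>
  ijk kl iB kB jC lC.
by rewrite (nQ B C (h i) (h j) (h k) (h l)).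
Qed.

Lemma sum_relabel (V : nmodType) (F : {set {set 'I_N}} -> V) :
  \sum_(Q in ncpart (h @: setT)) F Q = \sum_(P in NC m) F (push P).
Proof. by rewrite -push_ncpart big_imset // => P P' _ _; apply: push_inj. Qed.

End Relabel.

Section Glue.
Variables (N : nat) (T : finType) (q : 'I_N -> T).
Hypothesis q_nc : forall i j k l : 'I_N, (i < j < k)%N -> (k < l)%N ->
  q i = q k -> q j = q l -> q i = q j.
Implicit Types (P : {set {set 'I_N}}) (B C : {set 'I_N}).

Definition fiber (t : T) : {set 'I_N} := [set i | q i == t].

Lemma ssetI_fiber_ncpart P t :
  P \in NC N -> monochromatic q P -> P ::&: fiber t \in ncpart (fiber t).
Proof.
move=> PNC mP; have [neP covP tP nP] := ncpartP _ _ PNC; apply/ncpartP; split.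
- by move=> B; rewrite inE => /andP[/neP].
- move=> i; split=> [it|[B]]; last first.
    by rewrite inE => /andP[_ /subsetP]; apply.
  have [B BP iB] := (covP i).1 (in_setT i); exists B => //.
  rewrite inE BP; apply/subsetP => j jB; move: it; rewrite !inE.
  by rewrite (monoP _ _ mP B i j).
- by move=> B C i; rewrite !inE => /andP[BP _] /andP[CP _]; apply: tP.
- by move=> B C i j k l; rewrite !inE => /andP[BP _] /andP[CP _]; apply: nP.
Qed.

(** Blocks taken from different classes do not cross because the classes
    themselves do not. *)
Lemma glue_ncpart (f : {ffun T -> {set {set 'I_N}}}) :
  (forall t, f t \in ncpart (fiber t)) ->
  [/\ \bigcup_t f t \in NC N, monochromatic q (\bigcup_t f t)
    & forall t, (\bigcup_t f t) ::&: fiber t = f t].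
Proof.
move=> fP.
have fE t B i : B \in f t -> i \in B -> q i = t.
  have [_ covP _ _] := ncpartP _ _ (fP t).
  move=> Bt iB; apply/eqP; suff : i \in fiber t by rewrite inE.
  by apply/covP; exists B.
have sameB B C t i j : B \in f t -> C \in f (q j) -> i \in B -> q i = q j -> C \in f t.
  by move=> Bt Cs iB ij; rewrite -(fE t B i) // ij.
split.
- rewrite NCE; apply/ncpartP; split.
  + by move=> B /bigcupP[t _]; have [neP _ _ _] := ncpartP _ _ (fP t); apply: neP.
  + move=> i; rewrite in_setT; split=> // _; have [_ covP _ _] := ncpartP _ _ (fP (q i)).
    have [|B Bt iB] := (covP i).1; first by rewrite inE.
    by exists B => //; apply/bigcupP; exists (q i).
  + move=> B C i /bigcupP[t _ Bt] /bigcupP[s _ Cs] iB iC.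
    have ts : t = s by rewrite -(fE t B i) // (fE s C i).
    have [_ _ tP _] := ncpartP _ _ (fP t).
    by apply: (tP B C i); rewrite // ts.
  move=> B C i j k l /bigcupP[t _ Bt] /bigcupP[s _ Cs] ijk kl iB kB jC lC.
  have ts : t = s.
    rewrite -(fE t B i) // -(fE s C j) //; apply: (q_nc ijk kl).
      by rewrite (fE t B i) // (fE t B k).
    by rewrite (fE s C j) // (fE s C l).
  have [_ _ _ nP] := ncpartP _ _ (fP t).
  by apply: (nP B C i j k l); rewrite // ts.
- apply/monoP => B i j /bigcupP[t _ Bt] iB jB.
  by rewrite (fE t B i) // (fE t B j).
move=> t; have [neP covP _ _] := ncpartP _ _ (fP t).
apply/setP => B; rewrite inE; apply/andP/idP => [[/bigcupP[s _ Bs] /subsetP Bt]|Bt].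
  have [neS _ _ _] := ncpartP _ _ (fP s).
  have [x xB] := neS B Bs; have := Bt x xB; rewrite inE (fE s B x) // => /eqP <- //.
split; first by apply/bigcupP; exists t.
by apply/subsetP => i iB; rewrite inE (fE t B i).
Qed.

(** If the classes of a colouring [q] do not cross, a noncrossing partition
    monochromatic for [q] amounts to an independent choice of a noncrossing
    partition of each class; so the sum over such partitions is distributed
    into a product. Classes may be empty, and then contribute the empty
    partition. *)
Lemma sum_glue (K : comPzRingType) (F : T -> {set {set 'I_N}} -> K) :
  \sum_(P in NC N | monochromatic q P) \prod_t F t (P ::&: fiber t)
  = \prod_t \sum_(P in ncpart (fiber t)) F t P.
Proof.
rewrite bigA_distr_big_dep.
rewrite (reindex_onto (fun f : {ffun T -> {set {set 'I_N}}} => \bigcup_t f t)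
   (fun P => [ffun t => P ::&: fiber t])) /=; last first.
  move=> P /andP[PNC mP]; apply/setP => B; apply/bigcupP/idP => [[t _]|BP].
    by rewrite ffunE inE => /andP[].
  have [neP _ _ _] := ncpartP _ _ PNC; have [x xB] := neP B BP.
  exists (q x) => //; rewrite ffunE inE BP; apply/subsetP => y yB.
  by rewrite inE (monoP _ _ mP B y x).
apply: eq_big => f.
  apply/andP/familyP => [[/andP[fNC mf] /eqP fE] t|fP].
    by rewrite -fE ffunE; apply: ssetI_fiber_ncpart.
  have [fNC mf fE] := glue_ncpart fP; rewrite fNC mf; split=> //.
  by apply/eqP/ffunP => t; rewrite ffunE fE.
move=> /andP[_ /eqP fE]; apply: eq_bigr => t _.
by rewrite -[in RHS]fE ffunE.
Qed.

Lemma card_glue P : P \in NC N -> monochromatic q P ->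
  #|P| = (\sum_t #|P ::&: fiber t|)%N.
Proof.
move=> PNC mP; have [neP _ _ _] := ncpartP _ _ PNC.
have sumE t : #|P ::&: fiber t| = (\sum_(B in P) (B \subset fiber t))%N.
  rewrite -sum1_card big_mkcond [RHS]big_mkcond; apply: eq_bigr => B _.
  by rewrite inE; case: (B \in P) => //=; case: (_ \subset _).
rewrite (eq_bigr _ (fun t _ => sumE t)) exchange_big -sum1_card /=.
apply: eq_bigr => B BP; have [y yB] := neP B BP.
rewrite (bigD1 (q y)) //= big1 ?addn0 => [|t tq].
  by have -> // : B \subset fiber (q y);
     apply/subsetP => z zB; rewrite inE (monoP _ _ mP B z y).
case: (boolP (_ \subset _)) => // /subsetP/(_ y yB).
by rewrite inE eq_sym (negPf tq).
Qed.

Lemma mono_glue (J : eqType) (c : 'I_N -> J) P : P \in NC N -> monochromatic q P ->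
  monochromatic c P = [forall t, monochromatic c (P ::&: fiber t)].
Proof.
move=> PNC mP; have [neP _ _ _] := ncpartP _ _ PNC.
apply/idP/forallP => [/monoP mc t|mc]; apply/monoP => B i j BP iB jB.
  by apply: (mc B); move: BP; rewrite ?inE // => /andP[].
apply: (monoP _ _ (mc (q i)) B) => //; rewrite inE BP; apply/subsetP => y yB.
by rewrite inE (monoP _ _ mP B y i).
Qed.

End Glue.

(** * Ordered products along a word *)

Section Words.

Lemma enum_val_ltn N (D : {pred 'I_N}) (i j : 'I_#|D|) :
  (enum_val i < enum_val j)%N = (i < j)%N.
Proof.
have x0 : 'I_N by apply: (enum_val i).
have sD : sorted ltn (map val (enum D)).
  rewrite sorted_map /enum_mem -enumT; apply: sorted_filter.
    by move=> a b c; apply: ltn_trans.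
  by rewrite -sorted_map val_enum_ord; apply: iota_ltn_sorted.
have lt_ev (k l : 'I_#|D|) : (k < l)%N -> (enum_val k < enum_val l)%N.
  move=> kl; have size_D : size (map val (enum D)) = #|D| by rewrite size_map -cardE.
  have := sorted_ltn_nth ltn_trans 0%N sD.
  move=> /(_ k l); rewrite !inE size_D => /(_ (ltn_ord k) (ltn_ord l) kl).
  by rewrite !(nth_map x0) -?cardE // -!enum_val_nth.
have [ij|ji|/ord_inj ->] := ltngtP i j; last by rewrite ltnn.
  exact: lt_ev.
by apply/negbTE; rewrite -leqNgt ltnW // lt_ev.
Qed.

Variables (A : pzSemiRingType).

Lemma big_prod_enum_val N (Q : pred 'I_N) (F : 'I_N -> A) :
  \prod_(i | Q i) F i = \prod_(j < #|Q|) F (enum_val j).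
Proof.
rewrite -big_filter deprecated_filter_index_enum.
have -> : enum Q = [seq enum_val j | j <- enum 'I_#|Q|].
  have [Q0|] := posnP #|Q|.
    have -> : enum Q = [::] by apply/size0nil; rewrite -cardE.
    by rewrite (size0nil (s := enum _)) // size_enum_ord.
  move=> /card_gt0P[x0 _]; apply: (@eq_from_nth _ x0).
    by rewrite size_map size_enum_ord cardE.
  move=> k kQ; rewrite -cardE in kQ; pose k' := Ordinal kQ.
  rewrite (nth_map k') ?size_enum_ord // -[k in RHS]/(val k') nth_ord_enum.
  by rewrite (enum_val_nth x0).
by rewrite big_map enumT; congr (\big[_/_]_(_ <- _) _); rewrite [index_enum _]unlock.
Qed.

(** No commutativity is needed because the factors with [a] come first. *)
Lemma prod_split_initial (T : eqType) (s : seq T) (Q a : pred T) (F : T -> A) :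
  pairwise (fun t u => a u ==> a t) s ->
  \prod_(t <- s | Q t) F t
  = \prod_(t <- s | Q t && a t) F t * \prod_(t <- s | Q t && ~~ a t) F t.
Proof.
elim: s => [|t s IH] /=; first by rewrite !big_nil mulr1.
case/andP=> ts /IH{IH}; rewrite !big_cons.
have [at_|nat_] := boolP (a t).
  by rewrite andbT andbF => ->; case: (Q t); rewrite ?mulrA.
rewrite andbT andbF => _.
have -> : \prod_(u <- s | Q u && a u) F u = 1.
  rewrite big_seq_cond big1 // => u /and3P[us _ au].
  by move/allP/(_ u us): ts; rewrite au (negPf nat_).
have -> : \prod_(u <- s | Q u && ~~ a u) F u = \prod_(u <- s | Q u) F u.
  rewrite big_seq_cond [RHS]big_seq_cond; apply: eq_bigl => u.
  case: (boolP (u \in s)) => //= us; move/allP/(_ u us): ts.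
  by case: (a u); rewrite ?(negPf nat_) ?andbT.
by rewrite mul1r.
Qed.

(** The factors with the same label are consecutive because the label is
    nondecreasing, so they are grouped without commutativity. *)
Lemma prod_group N (r : 'I_N -> nat) (m : nat) (Q : pred nat) (F : 'I_N -> A) :
  (forall i j : 'I_N, (i <= j)%N -> (r i <= r j)%N) ->
  \prod_(i | Q (r i) && (r i < m)%N) F i
  = \prod_(k < m | Q k) \prod_(i | r i == k) F i.
Proof.
move=> r_mono; elim: m => [|m IH].
  by rewrite big_ord0 big1 // => i; rewrite ltn0 andbF.
rewrite [RHS]big_mkcond [RHS]big_ord_recr /= -(big_mkcond (fun k : 'I_m => Q k)) -IH.
rewrite (@prod_split_initial _ _ _ (fun i : 'I_N => (r i < m)%N)); last first.
  have : pairwise ltn (map val (index_enum 'I_N)).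
    rewrite [index_enum _]unlock -enumT val_enum_ord -(sorted_pairwise ltn_trans).
    exact: iota_ltn_sorted.
  rewrite pairwise_map; apply: sub_pairwise => i j /= ij; apply/implyP.
  by apply: leq_ltn_trans; apply: r_mono; apply: ltnW.
congr (_ * _).
  by apply: eq_bigl => i; case: (Q _) => //=; clear; lia.
case: ifP => Qm; last first.
  rewrite big1 // => i /andP[/andP[Qi ri] nri].
  have rim : r i = m by clear -ri nri; lia.
  by rewrite rim Qm in Qi.
apply: eq_bigl => i; case: (eqVneq (r i) m) => [->|neq]; first by rewrite Qm ltnn ltnSn.
by case: (Q _) => //=; clear -neq; lia.
Qed.

End Words.

(** * Runs of a word *)

Section Runs.
Variables (I : eqType) (c : nat -> I).

(** The number of colour changes before a position, that is, the index of the
    maximal constant run which contains the position. *)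
Definition run_index (i : nat) : nat := (\sum_(j < i) (c j != c j.+1))%N.

Lemma runS i : run_index i.+1 = (run_index i + (c i != c i.+1))%N.
Proof. by rewrite /run_index big_ord_recr. Qed.

Lemma run_mono i j : (i <= j)%N -> (run_index i <= run_index j)%N.
Proof.
move=> /subnK <-; elim: (j - i)%N => // d IH; rewrite addSn runS.
exact: leq_trans IH (leq_addr _ _).
Qed.

Lemma run_lt i j : (run_index i < run_index j)%N -> (i < j)%N.
Proof. by rewrite !ltnNge; apply: contra; apply: run_mono. Qed.

Lemma run_eq i j : run_index i = run_index j -> c i = c j.
Proof.
wlog ij : i j / (i <= j)%N => [wl|].
  by have [/wl//|/ltnW ji] := leqP i j; move=> /esym /(wl _ _ ji) ->.
rewrite -(subnK ij); elim: (j - i)%N => // d IH; rewrite addSn runS => rd.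
have le_d : (run_index i <= run_index (d + i))%N by apply: run_mono; apply: leq_addl.
have [eqc|neqc] := eqVneq (c (d + i)%N) (c (d + i).+1); last first.
  by rewrite rd neqc addn1 ltnn in le_d.
by rewrite -eqc; apply: IH; rewrite rd eqc eqxx addn0.
Qed.

Lemma run_step k t : (k < run_index t)%N ->
  exists i, [/\ (i < t)%N, run_index i = k & run_index i.+1 = k.+1].
Proof.
elim: t => [|t IH]; first by rewrite /run_index big_ord0.
rewrite runS; case: (ltnP k (run_index t)) => [/IH[s [st rs rs1]] _|tk].
  by exists s; split=> //; apply: ltnW.
move=> kt; exists t; rewrite runS; move: kt tk; clear; case: (_ != _) => /= ? ?; split; lia.
Qed.

Lemma run_neq i j : run_index j = (run_index i).+1 -> c i != c j.
Proof.
move=> rj; have [|s [_ rs rs1]] := @run_step (run_index i) j; first by rewrite rj.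
rewrite -(run_eq rs) (run_eq (etrans rj (esym rs1))).
by move: rs1; rewrite runS rs; case: (_ != _) => //=; rewrite addn0 => /n_Sn.
Qed.

(** Some run is a union of blocks. Otherwise take two points in the same block
    and in different runs, as close to each other as possible. They have the
    same colour, so their runs are not adjacent, and the run that follows the
    first one lies strictly between them; a block that leaves this run either
    crosses the chosen block or contains a closer pair. *)
Lemma isolated_run N (P : {set {set 'I_N.+1}}) : P \in NC N.+1 ->
  monochromatic (fun i : 'I_N.+1 => c i) P ->
  exists2 k, (k <= run_index N)%N & monochromatic (fun i : 'I_N.+1 => run_index i == k) P.
Proof.
move=> PNC; have partP := NC_partition PNC; move=> /(monoTP _ partP) mc.
pose bad (p : 'I_N.+1 * 'I_N.+1) := (p.2 \in pblock P p.1) &&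
  (run_index p.1 < run_index p.2)%N.
have [/existsP[p0 bad0]|nobad] := boolP [exists p, bad p]; last first.
  exists 0%N => //; apply/(monoTP _ partP) => x y xy.
  have nb u v : v \in pblock P u -> (run_index v <= run_index u)%N.
    move=> uv; rewrite leqNgt; apply: contra nobad => ruv.
    by apply/existsP; exists (u, v); rewrite /bad uv.
  have := nb x y xy; have := nb y x; rewrite pblock_sym // => /(_ xy) ??.
  by congr (_ == _); apply/eqP; rewrite eqn_leq; apply/andP.
have [[i j] /andP[/= ij rij] minij] :=
  @arg_minnP _ p0 bad (fun p => p.2 - p.1)%N bad0.
exists (run_index i).+1; first by apply: leq_trans rij (run_mono _); rewrite -ltnS.
have cij := mc _ _ ij.
have in_gap x : run_index x = (run_index i).+1 -> (i < x < j)%N.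
  move=> rx; apply/andP; split; first by apply: run_lt; rewrite rx.
  apply: run_lt; rewrite rx ltn_neqAle rij andbT; apply/eqP => rj.
  by have := run_neq (esym rj); rewrite cij eqxx.
have isolated (x y : 'I_N.+1) : y \in pblock P x -> run_index x = (run_index i).+1 ->
  run_index y = (run_index i).+1.
  move=> xy rx; have /andP[ix xj] := in_gap x rx.
  have nix : x \notin pblock P i.
    by apply/negP => /mc cix; have := run_neq rx; rewrite cix eqxx.
  have niy : y \notin pblock P i.
    apply: contra nix; rewrite -!eq_pblockT // => /eqP ->.
    by rewrite eq_sym eq_pblockT.
  have iy : (i < y)%N.
    have [yi|//|/ord_inj yi] := ltngtP y i; last by rewrite yi mem_pblockT in niy.
    case/negP: niy; rewrite pblock_sym //.
    apply: (NC_cross PNC (i := y) (j := i) (k := x) (l := j)) => //.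
      by rewrite yi.
    by rewrite pblock_sym.
  have yj : (y < j)%N.
    have [//|jy|/ord_inj yj] := ltngtP y j; last by rewrite yj ij in niy.
    case/negP: nix; apply: (NC_cross PNC (i := i) (j := x) (k := j) (l := y)) => //.
    by rewrite ix.
  have [rxy|ryx|ryx] := ltngtP (run_index x) (run_index y); last by rewrite -ryx.
    have := minij (x, y); rewrite /bad /= xy rxy => /(_ isT).
    by clear -ix iy xj yj; lia.
  have := minij (y, x); rewrite /bad /= pblock_sym // xy ryx => /(_ isT).
  by clear -ix iy xj yj; lia.
apply/(monoTP _ partP) => x y xy; apply/eqP/eqP; first exact: isolated.
by apply: isolated; rewrite pblock_sym.
Qed.

End Runs.

(** * Moments of free variables *)

Section FreeMoments.
Variables (K : fieldType) (A : algType K) (phi : {scalar A}).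
Hypothesis phi1 : phi 1 = 1.
Variables (I : eqType) (x : I -> A) (lam : K).
Hypothesis free_x : free_family phi x.
Hypothesis moment_x : forall t k, phi (x t ^+ k) = \sum_(P in NC k) lam ^+ #|P|.

(** The candidate for the moment of the subword of [c] at the positions of
    [D]. *)
Definition color_sum N (D : {set 'I_N}) (c : nat -> I) : K :=
  \sum_(P in ncpart D | monochromatic (fun i : 'I_N => c i) P) lam ^+ #|P|.

Lemma sum_enum_val (V : nmodType) N (D : {set 'I_N}) (F : {set {set 'I_N}} -> V) :
  \sum_(P in ncpart D) F P = \sum_(P in NC #|D|) F (push (@enum_val _ (mem D)) P).
Proof.
rewrite -(sum_relabel (h := @enum_val _ (mem D))); last exact: enum_val_ltn.
suff -> : @enum_val _ (mem D) @: setT = D by [].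
apply/setP => i; apply/imsetP/idP => [[j _ ->]|iD]; first exact: enum_valP.
by exists (enum_rank_in iD i); rewrite ?enum_rankK_in.
Qed.

Lemma color_sum_const N (D : {set 'I_N}) (c : nat -> I) t :
  (forall i : 'I_N, i \in D -> c i = t) -> color_sum D c = phi (x t ^+ #|D|).
Proof.
move=> cD; rewrite moment_x /color_sum (eq_bigl (mem (ncpart D))) => [|P].
  rewrite sum_enum_val; apply: eq_bigr => P _; rewrite card_push //.
  exact: enum_val_ltn.
rewrite /=; case: (boolP (P \in ncpart D)) => //= PD.
have [_ covP _ _] := ncpartP _ _ PD.
apply/monoP => B i j BP iB jB; rewrite !cD //; apply/covP; by exists B.
Qed.

Lemma phi_sub_word N (D : {set 'I_N}) (c : nat -> I) :
  (forall d : nat -> I, phi (\prod_(i < #|D|) x (d i)) = color_sum [set: 'I_#|D|] d) ->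
  phi (\prod_(i | i \in D) x (c i)) = color_sum D c.
Proof.
move=> IH; rewrite big_prod_enum_val.
pose d (k : nat) := c (nth 0%N (map val (enum D)) k).
have dE (j : 'I_#|D|) : d j = c (enum_val j).
  by rewrite /d (nth_map (enum_val j)) -?cardE ?ltn_ord // -enum_val_nth.
transitivity (phi (\prod_(j < #|D|) x (d j))).
  by congr (phi _); apply: eq_bigr => j _; rewrite dE.
rewrite IH /color_sum big_mkcondr [RHS]big_mkcondr [RHS]sum_enum_val.
apply: eq_bigr => P _; rewrite mono_push card_push; last exact: enum_val_ltn.
by rewrite (eq_mono _ dE).
Qed.

Section Expansion.
Variables (N : nat) (c : nat -> I).
Local Notation m := (run_index c N).+1.

Lemma run_bound (i : 'I_N.+1) : (run_index c i < m)%N.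
Proof. by rewrite ltnS run_mono // -ltnS. Qed.

Definition run_of (i : 'I_N.+1) : 'I_m := Ordinal (run_bound i).
Definition run_set (k : 'I_m) : {set 'I_N.+1} := [set i | run_of i == k].
Definition unrun_set (S : {set 'I_m}) : {set 'I_N.+1} := [set i | run_of i \notin S].

Lemma run_repr : exists f : 'I_m -> 'I_N.+1, forall k, run_of (f k) = k.
Proof.
suff /fin_all_exists[f fP] : forall k : 'I_m, exists i, run_of i = k by exists f.
move=> k; have := ltn_ord k; rewrite ltnS leq_eqVlt => /orP[/eqP kN|].
  by exists ord_max; apply/ord_inj; rewrite /= kN.
case/run_step => i [iN ri _]; have iN1 : (i < N.+1)%N by apply: ltnW.
by exists (Ordinal iN1); apply/ord_inj.
Qed.

Lemma prod_scaled (T : Type) (s : seq T) (S : pred T) (a : T -> K) (y : T -> A) :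
  \prod_(k <- s) (if S k then (a k)%:A else y k)
  = (\prod_(k <- s | S k) a k) *: \prod_(k <- s | ~~ S k) y k.
Proof.
elim: s => [|k s IH]; first by rewrite !big_nil scale1r.
rewrite !big_cons IH; case: (S k) => /=.
  by rewrite mulr_algl scalerA.
by rewrite scalerAr.
Qed.

Lemma prod_runs (S : {set 'I_m}) (f : 'I_m -> 'I_N.+1) :
  (forall k, run_of (f k) = k) ->
  \prod_(k | k \notin S) x (c (f k)) ^+ #|run_set k|
  = \prod_(i | i \in unrun_set S) x (c i).
Proof.
move=> fP; rewrite (eq_bigl (fun i : 'I_N.+1 =>
    (inord (run_index c i) \notin S) && (run_index c i < m)%N)); last first.
  move=> i; rewrite inE run_bound andbT.
  have -> // : run_of i = inord (run_index c i).
  by apply/ord_inj; rewrite inordK // run_bound.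
rewrite (prod_group (r := run_index c) _ (fun k => inord k \notin S)) => [|i j];
  last by move=> ij; exact: (run_mono c ij).
apply: eq_big => [k|k _]; first by rewrite inord_val.
rewrite -prodr_const; apply: eq_big => [i|i]; first by rewrite inE -val_eqE.
rewrite inE => /eqP ik; congr x; apply: run_eq.
by rewrite -[LHS]/(val (run_of (f k))) fP -ik.
Qed.

(** Freeness applied to the product over the runs of the centred powers of
    letters, expanded over the set [S] of runs from which the constant term is
    taken. *)
Lemma free_expansion (f : 'I_m -> 'I_N.+1) (mu : 'I_m -> K) :
  (forall k, run_of (f k) = k) ->
  (forall k, mu k = phi (x (c (f k)) ^+ #|run_set k|)) ->
  \sum_(S : {set 'I_m})
    (\prod_(k in S) - mu k) * phi (\prod_(i | i \in unrun_set S) x (c i)) = 0.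
Proof.
move=> fP muE.
pose t (k : nat) := c (f (inord k)).
pose p (k : nat) : {poly K} :=
  'X^(#|run_set (inord k)|) - (mu (inord k))%:P.
have pE k : horner_alg (x (t k)) (p k)
    = x (t k) ^+ #|run_set (inord k)| + (- mu (inord k))%:A.
  by rewrite /p rmorphB rmorphXn /= horner_algX horner_algC scaleNr.
have := free_x (m := m) (i := t) (p := p).
rewrite (eq_bigr (fun k : 'I_m => (- mu k)%:A + x (c (f k)) ^+ #|run_set k|)); last first.
  by move=> k _; rewrite pE /t inord_val addrC.
rewrite bigA_distr linear_sum /= => free0; rewrite -[RHS]free0 //.
- apply: eq_bigr => S _; rewrite prod_scaled linearZ /=; congr (_ * phi _).
  by rewrite prod_runs.
- move=> k km; have run_f l : (l < m)%N -> run_index c (f (inord l)) = l.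
    by move=> lm; rewrite -[LHS]/(val (run_of (f (inord l)))) fP /= inordK.
  by apply: (@run_neq _ c); rewrite !run_f // ltnW.
move=> k km; rewrite pE linearD linearZ /= phi1 mulr1 muE /t.
by rewrite addrN.
Qed.

(** Each run in [S] is separated from all the others, and the runs outside [S]
    are left together under the label [ord0]. *)
Definition cut_label (S : {set 'I_m}) (i : 'I_N.+1) : 'I_m.+1 :=
  if run_of i \in S then lift ord0 (run_of i) else ord0.

Lemma cut_in (S : {set 'I_m}) i :
  run_of i \in S -> cut_label S i = lift ord0 (run_of i).
Proof. by rewrite /cut_label => ->. Qed.

Lemma cut_notin (S : {set 'I_m}) i : run_of i \notin S -> cut_label S i = ord0.
Proof. by rewrite /cut_label => /negPf ->. Qed.

Lemma cut_eq (S : {set 'I_m}) i j :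
  run_of i \in S -> cut_label S i = cut_label S j -> run_of i = run_of j.
Proof.
move=> iS; rewrite cut_in //; have [jS|jS] := boolP (run_of j \in S).
  by rewrite cut_in // => /lift_inj.
by rewrite cut_notin // => /(congr1 val).
Qed.

Lemma cut_noncrossing (S : {set 'I_m}) (i j k l : 'I_N.+1) :
  (i < j < k)%N -> (k < l)%N -> cut_label S i = cut_label S k -> cut_label S j =
    cut_label S l ->
  cut_label S i = cut_label S j.
Proof.
have between (u v w : 'I_N.+1) : (u <= v <= w)%N -> run_of u = run_of w -> run_of v =
  run_of u.
  move=> /andP[uv vw] /(congr1 val) /= uw; apply/ord_inj/eqP; rewrite eqn_leq /=.
  by rewrite {1}uw !run_mono.
move=> /andP[ij jk] kl ik jl; have [iS|iS] := boolP (run_of i \in S).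
  have jri : run_of j = run_of i.
    by apply: (between i j k); rewrite ?(cut_eq iS ik) // (ltnW ij) ltnW.
  by rewrite /cut_label jri.
have [jS|jS] := boolP (run_of j \in S); last by rewrite !cut_notin.
have krj : run_of k = run_of j.
  by apply: (between j k l); rewrite ?(cut_eq jS jl) // (ltnW jk) ltnW.
by rewrite ik /cut_label krj.
Qed.

Lemma mono_cut (S : {set 'I_m}) (P : {set {set 'I_N.+1}}) :
  monochromatic (cut_label S) P = [forall k in S, monochromatic (fun i => run_of i == k) P].
Proof.
apply/monoP/forall_inP => [mS k kS|mS B i j BP iB jB].
  apply/monoP => B i j BP iB jB; have cij := mS B i j BP iB jB.
  apply/eqP/eqP => [ik|jk]; first by rewrite -(cut_eq _ cij) ik.
  by rewrite -(cut_eq _ (esym cij)) jk.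
have [iS|iS] := boolP (run_of i \in S).
  have := elimT (monoP _ _) (mS _ iS) B i j BP iB jB; rewrite eqxx => /esym/eqP ji.
  by rewrite /cut_label ji.
rewrite (cut_notin iS); have [jS|jS] := boolP (run_of j \in S); last by rewrite cut_notin.
have := elimT (monoP _ _) (mS _ jS) B i j BP iB jB; rewrite eqxx => /eqP ij.
by rewrite ij jS in iS.
Qed.

(** The product counts the partitions for which every run in [S] is isolated
    from the rest of the word. *)
Lemma color_sum_cut (S : {set 'I_m}) :
  (\prod_(k in S) color_sum (run_set k) c) * color_sum (unrun_set S) c
  = \sum_(P in NC N.+1 | monochromatic (fun i : 'I_N.+1 => c i) P)
      [forall k in S, monochromatic (fun i => run_of i == k) P]%:R * lam ^+ #|P|.
Proof.
pose F (P : {set {set 'I_N.+1}}) : K :=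
  if monochromatic (fun i : 'I_N.+1 => c i) P then lam ^+ #|P| else 0.
have FE D : color_sum D c = \sum_(P in ncpart D) F P by rewrite /color_sum big_mkcondr.
have F0 : \sum_(P in ncpart (set0 : {set 'I_N.+1})) F P = 1.
  rewrite ncpart0 big_set1 /F cards0 expr0 ifT //.
  by apply/monoP => B i j; rewrite inE.
transitivity (\prod_(t < m.+1) \sum_(P in ncpart (fiber (cut_label S) t)) F P).
  rewrite big_ord_recl mulrC; congr (_ * _).
    have -> : fiber (cut_label S) ord0 = unrun_set S; last exact: FE.
    apply/setP => i; rewrite !inE; have [iS|iS] := boolP (run_of i \in S);
      last by rewrite cut_notin.
    by rewrite cut_in.
  rewrite big_mkcond; apply: eq_bigr => k _.
  have -> : fiber (cut_label S) (lift ord0 k) = if k \in S then run_set k else set0.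
    apply/setP => i; rewrite inE; have [iS|iS] := boolP (run_of i \in S).
      rewrite cut_in // (inj_eq lift_inj); case: ifP => kS; rewrite inE //.
      by apply: contraFF kS => /eqP <-.
    rewrite cut_notin //; case: ifP => kS; rewrite inE //.
    by apply/esym; apply: contraNF iS => /eqP ->.
  by case: ifP => kS; rewrite ?FE.
rewrite -(sum_glue (@cut_noncrossing S) (fun _ => F)) big_mkcondr [RHS]big_mkcondr.
apply: eq_bigr => P PNC; rewrite -mono_cut.
have [mq|] := boolP (monochromatic (cut_label S) P); last by rewrite mul0r if_same.
rewrite mul1r (mono_glue _ PNC mq); case: ifP => [/forallP mc|/negbT].
  rewrite (card_glue PNC mq) expr_sum; apply: eq_bigr => t _.
  by rewrite /F mc.
rewrite negb_forall => /existsP[t nmt].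
by rewrite (bigD1 t) //= /F (negPf nmt) mul0r.
Qed.

(** The candidates satisfy the same relation as the moments: the contribution
    of a partition is multiplied by the alternating sum over the sets of runs
    it isolates, which vanishes because it isolates at least one. *)
Lemma color_sum_expansion :
  \sum_(S : {set 'I_m})
    (\prod_(k in S) - color_sum (run_set k) c) * color_sum (unrun_set S) c = 0.
Proof.
transitivity (\sum_(S : {set 'I_m}) \sum_(P in NC N.+1 | monochromatic (fun i :
  'I_N.+1 => c i) P)
    (\prod_k (if k \in S then - (monochromatic (fun i =>
      run_of i == k) P)%:R else 1)) * lam ^+ #|P|).
  apply: eq_bigr => S _.
  rewrite (eq_bigr (fun k => -1 * color_sum (run_set k) c)) => [|k _];
    last by rewrite mulN1r.
  rewrite big_split /= -mulrA color_sum_cut mulr_sumr; apply: eq_bigr => P _.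
  rewrite mulrA; congr (_ * _); rewrite -[RHS]big_mkcond /=.
  rewrite [RHS](eq_bigr (fun k => -1 * (monochromatic (fun i =>
    run_of i == k) P)%:R)) => [|k _]; last by rewrite mulN1r.
  rewrite big_split /=; congr (_ * _).
  have [/forall_inP allS|] := boolP [forall k in S, monochromatic (fun i =>
    run_of i == k) P].
    by rewrite big1 // => k kS; rewrite allS.
  rewrite negb_forall_in => /exists_inP[k kS nk].
  by rewrite (bigD1 k) //= (negPf nk) mul0r.
rewrite exchange_big big1 //= => P /andP[PNC mc].
(* The sum over [S] is the product over the runs [k] of [1 - 1] if [k] is
   isolated and [1 - 0] otherwise. *)
rewrite -mulr_suml -(bigA_distr _ _ (fun k => - (monochromatic (fun i =>
  run_of i == k) P)%:R) (fun=> 1)).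
have [k kN mk] := isolated_run PNC mc.
rewrite (bigD1 (Ordinal (kN : (k < m)%N))) //= (_ : monochromatic _ P =
  true) ?addNr ?mul0r //.
Qed.

End Expansion.

Lemma color_sumT N (c : nat -> I) : color_sum [set: 'I_N] c =
  \sum_(P in NC N | monochromatic (fun i : 'I_N => c i) P) lam ^+ #|P|.
Proof. by []. Qed.

(** The relation given by freeness expresses the moment of a word, which is
    the term with [S] empty, through moments of strictly shorter words and of
    powers of single letters; as the sums over noncrossing partitions obey the
    same relation, induction on the length concludes. *)
Theorem free_moment N (c : nat -> I) :
  phi (\prod_(i < N) x (c i)) = \sum_(P in NC N | monochromatic (fun i : 'I_N =>
    c i) P) lam ^+ #|P|.
Proof.
rewrite -color_sumT; elim/ltn_ind: N c => -[_ c|N IH c].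
  have T0 : [set: 'I_0] = set0 by apply/setP => -[].
  have mono0 : monochromatic (fun i : 'I_0 => c i) set0 by apply/monoP => B i j;
    rewrite inE.
  rewrite big_ord0 phi1 /color_sum T0 ncpart0 (big_pred1 set0) ?cards0 ?expr0 // => P.
  by rewrite in_set1 /=; case: eqP => // ->.
have [f fP] := run_repr N c.
have colorE k : color_sum (run_set k) c = phi (x (c (f k)) ^+ #|run_set k|).
  apply: color_sum_const => i; rewrite inE => /eqP ik; apply: run_eq.
  by rewrite -[RHS]/(val (run_of c (f k))) fP -ik.
have := free_expansion fP colorE; have := color_sum_expansion N c.
rewrite (bigD1 set0) //= [X in _ -> X = _ -> _](bigD1 set0) //= !big_set0 !mul1r.
have unrun0 : unrun_set (set0 : {set 'I_(run_index c N).+1}) = [set: 'I_N.+1].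
  by apply/setP => i; rewrite !inE.
rewrite unrun0 => color0; rewrite (eq_bigl predT) => [|i]; last by rewrite inE.
rewrite (eq_bigr (fun S : {set 'I_(run_index c N).+1} =>
    (\prod_(k in S) - color_sum (run_set k) c) *
    color_sum (unrun_set S) c)) => [phi0|S /set0Pn[k kS]].
  by apply: (addIr _ (etrans phi0 (esym color0))).
(* Removing a run shortens the word, because every run is nonempty. *)
rewrite phi_sub_word // => d; apply: IH.
rewrite -[X in (_ < X)%N]card_ord -cardsT; apply: proper_card; rewrite properT.
by apply/eqP => /setP/(_ (f k)); rewrite !inE fP kS.
Qed.

End FreeMoments.

(** * Colourings and decomposition into components *)

Section Colorings.
Variable n : nat.
Local Notation pt := 'I_(2 * n).
Implicit Types (P : {set {set pt}}) (Q : {set {set 'I_n}}) (B C : {set pt}).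
Implicit Types (i j x y : pt) (k l : 'I_n) (S U V : {set 'I_n}).

(** Two colourings differ by a function which is constant on components, and
    any such difference is allowed. *)
Lemma card_colorings P : partition P setT -> bipartite P ->
  #|[set S : {set 'I_n} | monochromatic (fun i => (edge_of i \in S) (+) odd i) P]| =
    (2 ^ #|components P|)%N.
Proof.
move=> partP /existsP[S0 /monoP mS0]; have partC := comp_partition P.
(* Swapping the two colours in the components that belong to [W]. *)
pose flip (W : {set {set 'I_n}}) : {set 'I_n} :=
  [set k | (k \in S0) (+) (pblock (components P) k \in W)].
have flipE k (W : {set {set 'I_n}}) : (pblock (components P) k \in W) =
  (k \in flip W) (+) (k \in S0).
  by rewrite inE addbAC addbb addFb.
rewrite -card_powerset -(card_in_imset (f := flip)); last first.
  suff sub (W W' : {set {set 'I_n}}) : W \subset components P -> flip W = flip W' ->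
    W \subset W'.
    move=> W W'; rewrite !powersetE => WC WC' eqW; apply/eqP.
    by rewrite eqEsubset (sub W W') // (sub W' W).
  move=> /subsetP WC eqW; apply/subsetP => V VW.
  have [_ tC C0] := and3P partC; have VC := WC V VW.
  have [k kV] : exists k, k \in V by apply/set0Pn; apply: contraNneq C0 => <-.
  by move: VW; rewrite -(def_pblock tC VC kV) !flipE eqW.
apply: eq_card => S; rewrite inE; apply/monoP/imsetP => [mS|[W _ ->] B i j BP iB jB];
  last first.
  have mW : monochromatic (fun x => pblock (components P) (edge_of x) \in W) P.
    apply: (@mono_comp _ _ (fun k => pblock (components P) k \in W)) => //.
    apply/(monoTP _ partC) => k l; rewrite -eq_pblockT // => /eqP -> //.
  rewrite !inE addbAC [RHS]addbAC (mS0 B i j BP iB jB).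
  by rewrite (monoP _ _ mW B i j BP iB jB).
have mD : monochromatic (fun i => edge_of i \in [set k | (k \in S) (+) (k \in S0)]) P.
  apply/monoP => B i j BP iB jB; rewrite !inE.
  have := congr2 addb (mS B i j BP iB jB) (mS0 B i j BP iB jB).
  by rewrite (addbACA _ (odd i)) (addbACA _ (odd j)) !addbb !addbF.
exists [set pblock (components P) k | k in [set k | (k \in S) (+) (k \in S0)]].
  by rewrite powersetE; apply/subsetP => _ /imsetP[k _ ->]; apply: pblockT.
apply/setP => k; rewrite inE.
have -> : (pblock (components P) k \in
    [set pblock (components P) l | l in [set k | (k \in S) (+) (k \in S0)]])
    = (k \in S) (+) (k \in S0); last by rewrite addbCA addbb addbF.
apply/imsetP/idP => [[l + kl]|kD]; last by exists k; rewrite ?inE.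
have lk : l \in pblock (components P) k by rewrite kl mem_pblockT.
by rewrite -(elimT (compP _ _ _) lk _ mD) inE.
Qed.

(** Labelling each point by the block of [Q] that contains its edge, [P]
    splits along [Q] when it is monochromatic for this label. *)
Definition color_of Q i : {set 'I_n} := pblock Q (edge_of i).

Lemma color_of_noncrossing Q (i j k l : pt) : Q \in NC n ->
  (i < j < k)%N -> (k < l)%N ->
  color_of Q i = color_of Q k -> color_of Q j = color_of Q l ->
  color_of Q i = color_of Q j.
Proof.
move=> QNC /andP[ij jk] kl; rewrite /color_of => ik jl; have partQ := NC_partition QNC.
have edge_le x y : (x < y)%N -> (edge_of x <= edge_of y)%N.
  by move=> xy; rewrite /= half_leq // ltnW.
have [ij'|] := eqVneq (edge_of i) (edge_of j); first by rewrite ij'.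
have [jk'|] := eqVneq (edge_of j) (edge_of k); first by rewrite ik jk'.
have [kl'|] := eqVneq (edge_of k) (edge_of l); first by rewrite ik jl kl'.
move=> nkl njk nij; apply/eqP; rewrite eq_pblockT //.
have lt x y : (x < y)%N -> edge_of x != edge_of y -> (edge_of x < edge_of y)%N.
  by move=> xy nxy; rewrite ltn_neqAle edge_le // andbT.
apply: (NC_cross QNC (k := edge_of k) (l := edge_of l)).
- by rewrite !lt.
- exact: lt.
- by rewrite -eq_pblockT // ik.
by rewrite -eq_pblockT // jl.
Qed.

(** A saturated set of edges meets each block of [Q] in a set which is
    saturated for the part of [P] above that block, and the blocks of [Q] are
    themselves saturated. *)
Lemma comp_eq P Q : P \in NC (2 * n) -> Q \in NC n ->
  (components P == Q)
  = monochromatic (color_of Q) P && [forall t, connected (P ::&: fiber (color_of Q) t)].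
Proof.
move=> PNC QNC; have partP := NC_partition PNC; have partQ := NC_partition QNC.
have partC := comp_partition P.
have block_sub t B x : monochromatic (color_of Q) P -> B \in P -> x \in B ->
    color_of Q x = t -> B \in P ::&: fiber (color_of Q) t.
  move=> /monoP mq BP xB xt; rewrite inE BP; apply/subsetP => y yB.
  by rewrite inE (mq B y x) // xt.
apply/eqP/andP => [CQ|[mq /forallP cq]].
  have mq : monochromatic (color_of Q) P.
    apply: (@mono_comp _ _ (pblock Q)) => //; rewrite CQ.
    by apply/(monoTP _ partQ) => k l; rewrite -eq_pblockT // => /eqP.
  split=> //; apply/forallP => t; apply/connP => S /monoP mS i j iP jP.
  have fibP x : x \in cover (P ::&: fiber (color_of Q) t) -> color_of Q x = t.
    case/bigcupP=> B; rewrite inE => /andP[_ /subsetP Bt] /Bt.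
    by rewrite inE => /eqP.
  (* [S] is only controlled above [t], so it is cut down to [t] to be saturated
     for the whole of [P]. *)
  pose S' := [set k in S | pblock Q k == t].
  have mS' : monochromatic (fun x => edge_of x \in S') P.
    apply/monoP => B x y BP xB yB; rewrite !inE.
    have := monoP _ _ mq B x y BP xB yB; rewrite /color_of => ->.
    have [yt|] := eqVneq (pblock Q (edge_of y)) t; last by rewrite !andbF.
    rewrite !andbT; apply: (mS B) => //; exact: block_sub yB yt.
  have ij : edge_of j \in pblock (components P) (edge_of i).
    by rewrite CQ -eq_pblockT //; apply/eqP; rewrite -!/(color_of Q _) !fibP.
  have := elimT (compP _ _ _) ij S' mS'.
  by rewrite !inE -!/(color_of Q _) !fibP // eqxx !andbT.
apply: eq_partition_pblock => // k l; apply/(compP P k l)/idP => [kl|kl S /monoP mS].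
  rewrite -(kl (pblock Q k)) ?mem_pblockT //.
  apply/monoP => B x y BP xB yB; rewrite -!(eq_pblockT k) //.
  by have := monoP _ _ mq B x y BP xB yB; rewrite /color_of => ->.
have in_cover m : pblock Q m = pblock Q k ->
    odd_pt m \in cover (P ::&: fiber (color_of Q) (pblock Q k)).
  move=> mk; apply/bigcupP; exists (pblock P (odd_pt m)); last exact: mem_pblockT.
  apply: (block_sub _ _ (odd_pt m)); rewrite ?mem_pblockT ?pblockT //.
  by rewrite /color_of edge_of_odd_pt.
have := elimT (connP _) (cq (pblock Q k)) S _ (odd_pt k) (odd_pt l).
rewrite !edge_of_odd_pt; apply; rewrite ?in_cover //; last first.
  by apply/esym/eqP; rewrite eq_pblockT.
by apply/monoP => B i j; rewrite inE => /andP[BP _]; apply: mS.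
Qed.

Lemma bip_glue P Q : P \in NC (2 * n) -> monochromatic (color_of Q) P ->
  bipartite P = [forall t, bipartite (P ::&: fiber (color_of Q) t)].
Proof.
move=> PNC /monoP mq; apply/existsP/forallP => [[S /monoP mS] t|bP].
  apply/existsP; exists S; apply/monoP => B i j; rewrite inE => /andP[BP _].
  exact: mS.
have /fin_all_exists[f fP] : forall t, exists S,
    monochromatic (fun i => (edge_of i \in S) (+) odd i) (P ::&: fiber (color_of Q) t).
  by move=> t; apply/existsP; exact: (bP t).
exists [set k | k \in f (pblock Q k)]; apply/monoP => B x y BP xB yB.
rewrite !inE -!/(color_of Q _) (mq B x y) //.
apply: (monoP _ _ (fP (color_of Q y)) B) => //.
by rewrite inE BP; apply/subsetP => z zB; rewrite inE (mq B z y).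
Qed.

End Colorings.

Section Restriction.
Variables (n : nat) (V : {set 'I_n}).
Local Notation m := #|V|.

(** The increasing embedding which doubles that of [V] in the set of edges, so
    that edges go to edges and parities are kept. *)
Definition lift_pt (i : 'I_(2 * m)) : 'I_(2 * n) :=
  let k := enum_val (edge_of i) in if odd i then even_pt k else odd_pt k.

Lemma edge_of_lift i : edge_of (lift_pt i) = enum_val (edge_of i).
Proof. by rewrite /lift_pt; case: ifP; rewrite ?edge_of_even_pt ?edge_of_odd_pt. Qed.

Lemma odd_lift i : odd (lift_pt i) = odd i.
Proof. by rewrite /lift_pt; case: ifP; rewrite ?odd_even_pt ?odd_odd_pt. Qed.

Lemma lift_pt_lt (i j : 'I_(2 * m)) : (lift_pt i < lift_pt j)%N = (i < j)%N.
Proof.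
have val_pt N (z : 'I_(2 * N)) : z = ((edge_of z).*2 + odd z)%N :> nat.
  by rewrite /= addnC odd_double_half.
rewrite (val_pt _ (lift_pt i)) (val_pt _ (lift_pt j)) !edge_of_lift !odd_lift.
rewrite [in RHS](val_pt _ i) [in RHS](val_pt _ j).
have := enum_val_ltn (edge_of i) (edge_of j); have := enum_val_ltn (edge_of j) (edge_of i).
move: (nat_of_ord (enum_val (edge_of i))) (nat_of_ord (enum_val (edge_of j))).
move: (nat_of_ord (edge_of i)) (nat_of_ord (edge_of j)) (odd i) (odd j).
by clear=> k l a b u v lk kl; case: a; case: b; lia.
Qed.

Lemma lift_pt_image : lift_pt @: setT = [set i | edge_of i \in V].
Proof.
apply/setP => i; rewrite inE; apply/imsetP/idP => [[j _ ->]|iV].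
  by rewrite edge_of_lift enum_valP.
pose k := enum_rank_in iV (edge_of i); have kE : enum_val k = edge_of i.
  by rewrite enum_rankK_in.
exists (if odd i then even_pt k else odd_pt k) => //; rewrite {1}(edge_ofK i) /lift_pt.
by case: (boolP (odd i)) => oi; rewrite ?odd_even_pt ?odd_odd_pt ?edge_of_even_pt
  ?edge_of_odd_pt kE.
Qed.

Lemma conn_push (P : {set {set 'I_(2 * m)}}) : partition P setT ->
  connected (push lift_pt P) = connected P.
Proof.
move=> partP; have [/eqP covP _ _] := and3P partP.
have coverE x : x \in cover (push lift_pt P) -> exists y, x = lift_pt y.
  by case/bigcupP=> _ /imsetP[B BP ->] /imsetP[y _ ->]; exists y.
have in_cover y : lift_pt y \in cover (push lift_pt P).
  apply/bigcupP; exists (lift_pt @: pblock P y); rewrite imset_f ?pblockT //.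
  by rewrite mem_pblockT.
apply/connP/(connTP partP) => [cP S mS k l|cP S mS x y].
  have memS j : (enum_val j \in [set enum_val i | i in S]) = (j \in S).
    exact: (mem_imset _ _ enum_val_inj).
  have := cP [set enum_val i | i in S] _ _ _ (in_cover (odd_pt k)) (in_cover (odd_pt l)).
  rewrite !edge_of_lift !edge_of_odd_pt !memS; apply.
  rewrite mono_push; rewrite -(eq_mono _ (c := fun i => edge_of i \in S)) // => i.
  by rewrite /= edge_of_lift memS.
move=> /coverE[{}x ->] /coverE[{}y ->]; rewrite !edge_of_lift.
have := cP [set i | enum_val i \in S] _ (edge_of x) (edge_of y); rewrite !inE; apply.
rewrite mono_push in mS; rewrite (eq_mono _ (d := fun i =>
  edge_of (lift_pt i) \in S)) // => i.
by rewrite inE edge_of_lift.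
Qed.

Lemma bip_push (P : {set {set 'I_(2 * m)}}) : bipartite (push lift_pt P) = bipartite P.
Proof.
apply/existsP/existsP => [[S mS]|[S mS]].
  exists [set i | enum_val i \in S]; rewrite mono_push in mS.
  rewrite (eq_mono _ (d := fun i =>
    (edge_of (lift_pt i) \in S) (+) odd (lift_pt i))) // => i.
  by rewrite inE edge_of_lift odd_lift.
exists [set enum_val i | i in S]; rewrite mono_push.
rewrite -(eq_mono _ (c := fun i => (edge_of i \in S) (+) odd i)) // => i.
by rewrite /= edge_of_lift odd_lift (mem_imset _ _ enum_val_inj).
Qed.

Lemma sum_restrict (K : nmodType) (F : nat -> K) :
  \sum_(P in ncpart [set i | edge_of i \in V] | connected P && bipartite P) F #|P|
  = \sum_(P in NCX m) F #|P|.
Proof.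
rewrite big_mkcondr -lift_pt_image sum_relabel; last exact: lift_pt_lt.
rewrite [RHS](eq_bigl (fun P => (P \in NC (2 * m)) && (connected P && bipartite P))) =>
  [|P]; last exact: NCXE.
rewrite [RHS]big_mkcondr; apply: eq_bigr => P PNC.
by rewrite conn_push ?NC_partition // bip_push card_push //; apply: lift_pt_lt.
Qed.

End Restriction.

(** Summing first over colourings gives [2 ^ c] for each partition with
    bipartite graph, where [c] is its number of components. The components
    form a noncrossing partition [Q], over each block of which a connected
    bipartite partition is chosen freely, and each block carries one factor 2.
    *)
Theorem sum_colorings (K : comPzRingType) (lam : K) n :
  \sum_(S : {set 'I_n}) \sum_(P in NC (2 * n) | monochromatic (fun i =>
    (edge_of i \in S) (+) odd i) P)
     lam ^+ #|P|
  = \sum_(Q in NC n) \prod_(V in Q) (2%:R * \sum_(P in NCX #|V|) lam ^+ #|P|).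
Proof.
transitivity (\sum_(P in NC (2 * n) | bipartite P) (2 ^ #|components P|)%:R * lam ^+ #|P|).
  rewrite (exchange_big_dep (mem (NC (2 * n)))) /= => [|S P _ /andP[]//].
  rewrite [RHS]big_mkcondr; apply: eq_bigr => P PNC.
  have [bP|nbP] := boolP (bipartite P).
    rewrite -card_colorings ?NC_partition // mulr_natl -sumr_const.
    by apply: eq_bigl => S; rewrite PNC inE.
  rewrite big1 // => S /andP[_ mS]; case/negP: nbP; apply/existsP; by exists S.
rewrite (partition_big (@components n) (mem (NC n))) => [|P /andP[PNC _]];
  last exact: comp_NC.
apply: eq_bigr => Q QNC; have partQ := NC_partition QNC.
pose F (P : {set {set 'I_(2 * n)}}) : K := if connected P &&
  bipartite P then lam ^+ #|P| else 0.
have sumF V : V \in Q ->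
    \sum_(P in NCX #|V|) lam ^+ #|P| = \sum_(P in ncpart (fiber (color_of Q) V)) F P.
  move=> VQ; rewrite -(sum_restrict _ (fun k => lam ^+ k)) big_mkcondr /=.
  apply: eq_bigl => P; have -> // : [set i | edge_of i \in V] = fiber (color_of Q) V.
  apply/setP => i; rewrite !inE; have [_ tQ _] := and3P partQ.
  apply/idP/eqP => [iV|<-]; first exact: def_pblock.
  exact: mem_pblockT.
have sum1 V : V \notin Q -> \sum_(P in ncpart (fiber (color_of Q) V)) F P = 1.
  move=> VQ; have -> : fiber (color_of Q) V = set0.
    by apply/setP => i; rewrite !inE; apply: contraNF VQ => /eqP <-; apply: pblockT.
  rewrite ncpart0 big_set1 /F cards0 expr0 ifT //; apply/andP; split.
    by apply/connP => S _ i j /bigcupP[B]; rewrite inE.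
  by apply/existsP; exists set0; apply/monoP => B i j; rewrite inE.
rewrite big_split /= prodr_const (eq_bigr _ sumF) -[X in _ = _ * X]mulr1.
transitivity (2%:R ^+ #|Q| * \prod_V \sum_(P in ncpart (fiber (color_of Q) V)) F P);
  last first.
  rewrite [in RHS]mulr1 [in RHS]big_mkcond; congr (_ * _); apply: eq_bigr => V _.
  by case: ifP => // /negbT /sum1.
rewrite -(sum_glue (fun i j k l => color_of_noncrossing QNC) (fun _ => F)) mulr_sumr.
rewrite big_mkcond [RHS]big_mkcond; apply: eq_bigr => P _.
have [PNC|//] := boolP (P \in NC _); rewrite /= comp_eq //.
have [mq|] := boolP (monochromatic _ P); last by rewrite andbF.
rewrite (bip_glue PNC mq) /= andbC.
have [/forallP cP|ncP] := boolP [forall t, connected (P ::&: fiber (color_of Q) t)];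
  last first.
  move: ncP; rewrite negb_forall => /existsP[t nt] /=.
  by rewrite (bigD1 t) //= /F (negPf nt) mul0r mulr0.
have [/forallP bP|nbP] := boolP [forall t, bipartite (P ::&: fiber (color_of Q) t)];
  last first.
  move: nbP; rewrite negb_forall => /existsP[t nt] /=.
  by rewrite (bigD1 t) //= /F (negPf nt) andbF mul0r mulr0.
have CQ : components P = Q.
  by apply/eqP; rewrite comp_eq // mq; apply/forallP.
rewrite /= CQ natrX (card_glue PNC mq) expr_sum; congr (_ * _); apply: eq_bigr => t _.
by rewrite /F cP bP.
Qed.

(** * Cumulants of the anticommutator *)

Section Cumulants.
Variables (K : fieldType) (A : algType K) (phi : {scalar A}).

Lemma moment_cumulant1 n (y : A) : (0 < n)%N ->
  phi (y ^+ n) = \sum_(P in NC n) \prod_(V in P) cumulant1 phi #|V| y.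
Proof.
move=> n_gt0.
have constant_word (s : seq A) : (0 < size s)%N -> s = nseq (size s) y ->
    phi (\prod_(z <- s) z) = \sum_(P in NC (size s)) \prod_(V in P) cumulant1 phi #|V| y.
  move=> s_gt0 sE; rewrite moment_cumulant //.
  apply: eq_bigr => P _; apply: eq_bigr => V _; congr (cumulant phi _).
  rewrite -[in RHS](size_restr_seq V); apply/all_pred1P/allP => _ /mapP[i _ ->] /=.
  by have := congr1 (fun u => nth 0 u i) sE; rewrite nth_nseq ltn_ord => ->.
have := constant_word (nseq n y); rewrite size_nseq => <- //.
by rewrite big_nseq -Monoid.iteropE.
Qed.

(** The one-block partition contributes the cumulant of highest order, and all
    the others only involve lower orders. *)
Lemma cumulant1_unique (y : A) (k : nat -> K) :
  (forall n, (0 < n)%N -> phi (y ^+ n) = \sum_(P in NC n) \prod_(V in P) k #|V|) ->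
  forall n, (0 < n)%N -> cumulant1 phi n y = k n.
Proof.
move=> mom; elim/ltn_ind => n IH n_gt0.
have := mom n n_gt0; rewrite moment_cumulant1 // (bigD1 [set setT]) ?oneblock_NC //=.
rewrite [RHS](bigD1 [set setT]) ?oneblock_NC //= !big_set1 cardsT card_ord.
set rest := \sum_(P in _ | _) _; set rest' := \sum_(P in _ | _) _.
suff -> : rest = rest' by apply: addIr.
apply: eq_bigr => P /andP[PNC nP]; apply: eq_bigr => V VP.
apply: IH; first exact: NC_block_proper PNC nP VP.
have [neP _ _ _] := ncpartP _ _ PNC; have [i iV] := neP V VP.
by apply/card_gt0P; exists i.
Qed.

Lemma NC0 : NC 0 = [set set0].
Proof. by rewrite NCE -ncpart0; congr ncpart; apply/setP => -[]. Qed.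

Lemma free_poisson_moment (lam : K) (y : A) : phi 1 = 1 -> free_poisson phi lam y ->
  forall k, phi (y ^+ k) = \sum_(P in NC k) lam ^+ #|P|.
Proof.
move=> phi1 poisson_y [|k]; first by rewrite NC0 big_set1 cards0 expr0.
rewrite moment_cumulant1 //; apply: eq_bigr => P PNC; rewrite -prodr_const.
apply: eq_bigr => V VP; apply: poisson_y.
have [neP _ _ _] := ncpartP _ _ PNC; have [x xV] := neP V VP.
by apply/card_gt0P; exists x.
Qed.

Lemma prod_pairs (n : nat) (y : nat -> A) :
  \prod_(k < n) (y (2 * k)%N * y (2 * k).+1) = \prod_(i < 2 * n) y i.
Proof.
elim: n => [|n IH]; first by rewrite muln0 !big_ord0.
have -> : (2 * n.+1 = (2 * n).+2)%N by rewrite mulnS.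
by rewrite !big_ord_recr /= -IH mulrA.
Qed.

(** Expanding the power gives one word for each way of choosing [a * b] or [b
    * a] in every factor; the two letters of a factor are the ends of an edge
    and have different colours. *)
Theorem anticommutator_moment (lam : K) (a b : A) (n : nat) :
  phi 1 = 1 -> free_pair phi a b -> free_poisson phi lam a -> free_poisson phi lam b ->
  phi ((a * b + b * a) ^+ n) =
  \sum_(Q in NC n) \prod_(V in Q) (2%:R * \sum_(P in NCX #|V|) lam ^+ #|P|).
Proof.
move=> phi1 free_ab poisson_a poisson_b; rewrite -sum_colorings.
pose x (e : bool) := if e then a else b.
have moment_x e k : phi (x e ^+ k) = \sum_(P in NC k) lam ^+ #|P|.
  by case: e; apply: free_poisson_moment.
pose c (S : {set 'I_n}) (i : nat) : bool :=
  [exists k : 'I_n, (k == i./2 :> nat) && (k \in S)] (+) odd i.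
have cE (S : {set 'I_n}) (i : 'I_(2 * n)) : c S i = (edge_of i \in S) (+) odd i.
  congr (_ (+) _); apply/existsP/idP => [[k /andP[/eqP ki kS]]|iS].
    by have -> : edge_of i = k by apply/ord_inj.
  by exists (edge_of i); rewrite eqxx.
rewrite -[in LHS](card_ord n) -prodr_const bigA_distr linear_sum /=.
apply: eq_big => [S|S _]; first by rewrite inE.
transitivity (phi (\prod_(i < 2 * n) x (c S i))).
  rewrite -(prod_pairs n (fun i => x (c S i))); congr (phi _).
  apply: eq_bigr => k _; rewrite -[(2 * k)%N]/(nat_of_ord (odd_pt k)).
  rewrite -[(odd_pt k).+1]/(nat_of_ord (even_pt k)) !cE.
  rewrite edge_of_odd_pt edge_of_even_pt odd_odd_pt odd_even_pt addbF addbT.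
  by case: (k \in S).
rewrite (free_moment phi1 free_ab moment_x); apply: eq_bigl => P.
by rewrite (eq_mono _ (cE S)).
Qed.

End Cumulants.

Theorem corollary1p6 (R : realType) (A : algType R[i]) (phi : {scalar A})
    (phi1 : phi 1 = 1) (lam : R[i]) (a b : A)
    (free_ab : free_pair phi a b)
    (poisson_a : free_poisson phi lam a)
    (poisson_b : free_poisson phi lam b)
    (n : nat) (n_gt0 : (0 < n)%N) :
  cumulant1 phi n (a * b + b * a) = 2%:R * \sum_(P in NCX n) lam ^+ #|P|
  /\ 2%:R * \sum_(P in NCX n) lam ^+ #|P|
     = 2%:R * \sum_(P in NCY n) lam ^+ (2 * n + 1 - #|P|)%N.
Proof.
split; last by rewrite (sum_NCX_NCY lam n_gt0).
apply: (cumulant1_unique (k := fun m => 2%:R * \sum_(P in NCX m) lam ^+ #|P|)) => // m _.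
exact: anticommutator_moment.
Qed.
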